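(* Let $d\geq 1$, let $A$ be a finite-dimensional algebra over a field and let $\mathcal{M}\subseteq\operatorname{mod}A$ be a $d$-cluster tilting subcategory. A subcategory $\mathcal{U}$ of $\mathcal{M}$ is a $d$-torsion class if and only if for any right $d$-exact sequence $$X\to Y_1\to Y_2\to\cdots\to Y_d\to Z\to 0$$ in $\mathcal{M}$ where $Y_i\to Y_{i+1}$ is a radical morphism for each $i=1,\dots,d-1$ and $X,Z\in\mathcal{U}$, we have $Y_1,\dots,Y_d\in\mathcal{U}$.
   Context: $\operatorname{mod}A$ is the category of finitely generated right $A$-modules. All subcategories are full and closed under isomorphisms, finite direct sums and direct summands. A functorially finite subcategory $\mathcal{M}\subseteq\operatorname{mod}A$ is $d$-cluster tilting if $\mathcal{M}=\{X\mid \operatorname{Ext}^i_A(X,M)=0\ \forall M\in\mathcal{M},\,1\le i\le d-1\}=\{Y\mid \operatorname{Ext}^i_A(M,Y)=0\ \forall M\in\mathcal{M},\,1\le i\le d-1\}$. A right $d$-exact sequence in $\mathcal{M}$ is a sequence $X_0\to X_1\to\cdots\to X_d\to X_{d+1}\to0$ with all $X_i\in\mathcal{M}$ which is exact in $\operatorname{mod}A$ at $X_1,\dots,X_{d+1}$. A morphism $f\colon X\to Y$ is radical if $1_X-gf$ is invertible for all $g\colon Y\to X$. A subcategory $\mathcal{U}\subseteq\mathcal{M}$ is a $d$-torsion class if for every $M\in\mathcal{M}$ there is an exact sequence $0\to U_M\to M\to V_1\to\cdots\to V_d\to 0$ in $\operatorname{mod}A$ with all terms in $\mathcal{M}$, such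 that $U_M\in\mathcal{U}$ and $0\to\operatorname{Hom}_A(U,V_1)\to\cdots\to\operatorname{Hom}_A(U,V_d)\to 0$ is exact for every $U\in\mathcal{U}$. *)

(* Defs.v *)
From HB Require Import structures.
From mathcomp Require Import all_boot all_order all_algebra all_field.

Set Implicit Arguments.
Unset Strict Implicit.
Unset Printing Implicit Defensive.

Import GRing.Theory.
Local Open Scope ring_scope.

(* Right A-modules are left modules over the converse ring A^c: the right
   action is x . a := (a : A^c) *: x, and
   (x . a) . b = b *: (a *: x) = (a * b : A) *: x = x . (a * b).            *)

Definition finitely_generated (R : pzRingType) (X : lmodType R) : Prop :=
  exists (n : nat) (x : 'I_n -> X),
    forall y : X, exists a : 'I_n -> R, y = \sum_(i < n) a i *: x i.

Record fgmod (k : fieldType) (A : falgType k) := FgMod {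
  fgmod_sort :> lmodType A^c;
  fgmod_fg : finitely_generated fgmod_sort
}.

Section ModuleCategory.
Variables (k : fieldType) (A : falgType k).

Definition surj (X Y : fgmod A) (f : {linear X -> Y}) : Prop :=
  forall y, exists x, f x = y.

Definition exact (X Y Z : fgmod A) (f : {linear X -> Y}) (g : {linear Y -> Z}) :
    Prop :=
  forall y, g y = 0 <-> exists x, f x = y.

Definition isomorphic (X Y : lmodType A^c) : Prop :=
  exists f : {linear X -> Y}, bijective f.

Definition radical (X Y : fgmod A) (f : {linear X -> Y}) : Prop :=
  forall g : {linear Y -> X}, bijective (fun x : X => x - g (f x)).

Record subcategory (S : fgmod A -> Prop) : Prop := Subcategory {
  subcategory_iso : forall X Y : fgmod A, isomorphic X Y -> S X -> S Y;
  subcategory_zero : forall X : fgmod A, (forall x : X, x = 0) -> S X;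
  subcategory_sum : forall X Y Z : fgmod A,
    isomorphic Z (X * Y)%type -> S X -> S Y -> S Z;
  subcategory_summand : forall X Y Z : fgmod A,
    isomorphic Z (X * Y)%type -> S Z -> S X
}.

Definition right_approximation (S : fgmod A -> Prop) (X S0 : fgmod A)
    (f : {linear S0 -> X}) : Prop :=
  S S0 /\ forall (S1 : fgmod A) (g : {linear S1 -> X}), S S1 ->
    exists h : {linear S1 -> S0}, forall x, f (h x) = g x.

Definition left_approximation (S : fgmod A -> Prop) (X S0 : fgmod A)
    (f : {linear X -> S0}) : Prop :=
  S S0 /\ forall (S1 : fgmod A) (g : {linear X -> S1}), S S1 ->
    exists h : {linear S0 -> S1}, forall x, h (f x) = g x.

Definition functorially_finite (S : fgmod A -> Prop) : Prop :=
  forall X : fgmod A,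
    (exists (S0 : fgmod A) (f : {linear S0 -> X}), right_approximation S f) /\
    (exists (S0 : fgmod A) (f : {linear X -> S0}), left_approximation S f).

Definition projective (P : fgmod A) : Prop :=
  forall (X Y : fgmod A) (e : {linear X -> Y}) (g : {linear P -> Y}),
    surj e -> exists h : {linear P -> X}, forall x, e (h x) = g x.

Definition projective_resolution (X : fgmod A) (P : nat -> fgmod A)
    (p : forall i, {linear P i.+1 -> P i}) (e : {linear P 0%N -> X}) : Prop :=
  [/\ forall i, projective (P i),
      surj e,
      exact (p 0%N) e
    & forall i, exact (p i.+1) (p i)].

(* Cochains of degree i in Hom_A(P, Y). *)
Definition cocycle (P : nat -> fgmod A) (p : forall i, {linear P i.+1 -> P i})
    (Y : fgmod A) (i : nat) (g : {linear P i -> Y}) : Prop :=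
  forall x, g (p i x) = 0.

Definition coboundary (P : nat -> fgmod A)
    (p : forall i, {linear P i.+1 -> P i}) (Y : fgmod A) (i : nat) :
    {linear P i -> Y} -> Prop :=
  match i with
  | 0 => fun g => forall x, g x = 0
  | j.+1 => fun g => exists h : {linear P j -> Y}, forall x, h (p j x) = g x
  end.

(* Ext^i_A(X, Y) = H^i(Hom_A(P, Y)) = 0, for P a projective resolution of X.
   Resolutions exist in mod A since A is finite-dimensional, and the cohomology
   does not depend on P, so the quantifier over P may be read either way.     *)
Definition Ext_vanishes (i : nat) (X Y : fgmod A) : Prop :=
  forall (P : nat -> fgmod A) (p : forall i, {linear P i.+1 -> P i})
         (e : {linear P 0%N -> X}),
    projective_resolution p e ->
    forall g : {linear P i -> Y}, cocycle p g -> coboundary p g.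

Definition cluster_tilting (d : nat) (M : fgmod A -> Prop) : Prop :=
  [/\ subcategory M,
      functorially_finite M,
      forall X : fgmod A, M X <->
        (forall N : fgmod A, M N ->
           forall i : nat, (1 <= i <= d - 1)%N -> Ext_vanishes i X N)
    & forall Y : fgmod A, M Y <->
        (forall N : fgmod A, M N ->
           forall i : nat, (1 <= i <= d - 1)%N -> Ext_vanishes i N Y)].

(* A sequence X_0 -> ... -> X_{d+1} is given by nat-indexed families of which
   only X 0, ..., X d.+1 and f 0, ..., f d are ever constrained.              *)
Definition right_exact_seq (d : nat) (M : fgmod A -> Prop) (X : nat -> fgmod A)
    (f : forall i, {linear X i -> X i.+1}) : Prop :=
  [/\ forall i, (i <= d.+1)%N -> M (X i),
      forall i, (i < d)%N -> exact (f i) (f i.+1)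
    & surj (f d)].

(* Exactness of 0 -> Hom(U, X_2) -> ... -> Hom(U, X_{d+1}) -> 0, stated at each
   Hom(U, X_{j+2}) with j < d: the term 0 on the right means that every map is
   in the kernel when j + 1 = d, the term 0 on the left that only 0 is in the
   image when j = 0 (for d = 1 this says Hom(U, X_2) = 0).                    *)
Definition hom_exact_seq (d : nat) (X : nat -> fgmod A)
    (f : forall i, {linear X i -> X i.+1}) (U : fgmod A) : Prop :=
  forall j, (j < d)%N -> forall h : {linear U -> X j.+2},
    ((j.+1 < d)%N -> forall u, f j.+2 (h u) = 0) <->
    (if j == 0%N then forall u, h u = 0
     else exists h' : {linear U -> X j.+1}, forall u, f j.+1 (h' u) = h u).

(* The sequence is 0 -> X_0 = U_N -> X_1 = N -> X_2 = V_1 -> ...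
   -> X_{d+1} = V_d -> 0. *)
Definition torsion_class (d : nat) (M U : fgmod A -> Prop) : Prop :=
  forall N : fgmod A, M N ->
    exists (X : nat -> fgmod A) (f : forall i, {linear X i -> X i.+1}),
      [/\ X 1%N = N, U (X 0%N), right_exact_seq d M f, injective (f 0%N)
        & forall U0 : fgmod A, U U0 -> hom_exact_seq d f U0].

End ModuleCategory.

(* Main.v *)
From HB Require Import structures.
From mathcomp Require Import all_boot all_order all_algebra all_field.
From mathcomp Require Import boolp zify.
Require Import Defs.

(** Why the theorem holds.

    Two facts about a cluster tilting subcategory M are used throughout; both
    come from Ext^i(M, M) = 0 for 0 < i < d by dimension shifting. For L in M,
    the functor Hom(-, L) is exact on right d-exact sequences, except at
    Hom(X_0, L) ([right_exact_extend]). For Y in M, the functor Hom(Y, -) is exact on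
    sequences 0 -> X_0 -> ... -> X_{d+1} -> 0 in M, except at X_{d+1}
    ([lift_inner]).

    From a torsion class to closedness. Let X_0 -> ... -> X_{d+1} -> 0 be right
    d-exact with X_m and X_{d+1} in U, put N = X_{m+1}, and take the torsion
    sequence 0 -> T -> N -> V_1 -> ... -> V_d -> 0. Maps from
    objects of U to N have image in T, so N -> V_1 kills X_m and extends to a
    chain map from the tail X_{m+2} -> ... -> X_{d+1} to V_1 -> V_2 -> ... .
    The tail ends in U, so the last component of the chain map lifts, and going
    back along the tail one obtains s : X_{m+2} -> N such that
    N -> X_{m+2} -> N -> V_1 equals N -> V_1 ([torsion_chase]). Hence
    1 - s f_{m+1} takes its values in T. If f_{m+1} is radical, this
    endomorphism is invertible, and N is a direct summand of T, thus in U. In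
    the last position the tail consists of an object of U only, and N -> V_1
    is already zero.

    From closedness to a torsion class. Let T be the trace of U in N. It is the
    image of a single map from an object of U, because N is Noetherian.
    Iterated left M-approximations coresolve every module in d steps, and
    splitting off superfluous summands makes each approximation left minimal;
    the maps of the coresolution are then radical ([coresolved_minimal]).
    So if 0 -> T -> Y_1 -> ... -> Y_d -> Z -> 0 is exact with Y_i in M and Z in
    U, closedness puts the left minimal part Y' of T -> Y_1 into U
    ([closed_factor]). This is used twice.

    - With Z = 0 and T -> Y_1 an approximation: the inclusion T -> N extends to
      Y_1, and maps from Y' to N land in T, so T is a summand of Y' and belongs
      to U ([trace_in_class]).

    - Let V_1 -> ... -> V_d coresolve N/T. By [lift_inner] it remains to lift
      maps Z -> V_d with Z in U to V_{d-1}. Dimension shifting reduces this to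
      lifting a map K -> V_1 to N, where K is the (d-1)-st syzygy of Z. The
      pullback E of N and K over V_1 is an extension of K by T, and left
      approximations of E can be glued to the projectives between K and Z
      to give an exact sequence 0 -> T -> Y_1 -> ... -> Y_d -> Z -> 0 in M in
      which T -> Y_1 factors through an approximation of E
      ([approx_coresolved]). As before, T is then a retract of Y_1 and hence of
      E, compatibly with E -> N; subtracting the retraction from E -> N gives
      a map that factors through K, and this is the lift ([lift_last]).

    For the dimension shifts, Ext is described by short exact sequences
    ([ext_zero], [Ext_vanishesP]). The approximations are injective because M
    contains the injective modules Hom_k(A, k^n), into which every module
    embeds. *)

Set Implicit Arguments.
Unset Strict Implicit.
Unset Printing Implicit Defensive.

Import GRing.Theory VectorInternalTheory.
Local Open Scope ring_scope.

(** * Linear maps, submodules and quotients *)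

Section LinearMaps.
Variable R : pzRingType.
Implicit Types U V W : lmodType R.

Definition mklin U V (f : U -> V) (lin_f : linear f) : {linear U -> V} :=
  HB.pack f (GRing.isLinear.Build R U V *:%R f lin_f).

Lemma lcomp_linear U V W (g : {linear V -> W}) (f : {linear U -> V}) :
  linear (fun x => g (f x)).
Proof. by move=> a x y; rewrite !linearP. Qed.
Definition lcomp U V W (g : {linear V -> W}) (f : {linear U -> V}) :=
  mklin (lcomp_linear g f).

Lemma ladd_linear U V (f g : {linear U -> V}) : linear (fun x => f x + g x).
Proof. by move=> a x y; rewrite !linearP scalerDr addrACA. Qed.
Definition ladd U V (f g : {linear U -> V}) := mklin (ladd_linear f g).

Lemma lopp_linear U V (f : {linear U -> V}) : linear (fun x => - f x).
Proof. by move=> a x y; rewrite linearP opprD scalerN. Qed.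
Definition lopp U V (f : {linear U -> V}) := mklin (lopp_linear f).
Definition lsub U V (f g : {linear U -> V}) := ladd f (lopp g).

Lemma lid_linear U : linear (fun x : U => x).
Proof. by []. Qed.
Definition lid U := mklin (@lid_linear U).

Lemma lzero_linear U V : linear (fun _ : U => 0 : V).
Proof. by move=> a x y; rewrite scaler0 addr0. Qed.
Definition lzero U V := mklin (@lzero_linear U V).

Lemma lfst_linear U V : linear (fun z : U * V => z.1).
Proof. by []. Qed.
Definition lfst U V := mklin (@lfst_linear U V).
Lemma lsnd_linear U V : linear (fun z : U * V => z.2).
Proof. by []. Qed.
Definition lsnd U V := mklin (@lsnd_linear U V).
Lemma lpair_linear U V W (f : {linear W -> U}) (g : {linear W -> V}) :
  linear (fun w => (f w, g w)).
Proof. by move=> a x y; rewrite !linearP. Qed.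
Definition lpair U V W (f : {linear W -> U}) (g : {linear W -> V}) :=
  mklin (lpair_linear f g).

Lemma factor_inj U V W (i : {linear V -> W}) (f : {linear U -> W}) :
  injective i -> (forall u, exists v, i v = f u) ->
  exists g : {linear U -> V}, forall u, i (g u) = f u.
Proof.
move=> inj_i /choice [g ig].
have lin_g : linear g.
  by move=> a x y; apply: inj_i; rewrite linearP !ig linearP.
by exists (mklin lin_g).
Qed.

Lemma factor_surj U V W (q : {linear U -> V}) (f : {linear U -> W}) :
  (forall v, exists u, q u = v) -> (forall u, q u = 0 -> f u = 0) ->
  exists g : {linear V -> W}, forall u, g (q u) = f u.
Proof.
move=> /choice [s qs] ker_q.
have fs u : f (s (q u)) = f u.
  by apply/eqP; rewrite -subr_eq0 -linearB ker_q // linearB qs subrr.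
have lin_g : linear (fun v => f (s v)).
  move=> a x y; rewrite -linearP -[in RHS]fs linearP !qs.
  by [].
by exists (mklin lin_g) => u; exact: fs.
Qed.

Definition submodule V (P : V -> Prop) :=
  P 0 /\ forall a u v, P u -> P v -> P (a *: u + v).

Section SubQuotient.
Variables (V : lmodType R) (P : V -> Prop) (subP : submodule P).

(** The proof that [P] is a submodule is an argument, so that the closure
    properties of the predicate can be attached to it as instances. *)
Definition submod_pred of submodule P : {pred V} := fun v => `[< P v >].

Lemma submod_predP v : reflect (P v) (v \in submod_pred subP).
Proof. exact: asboolP. Qed.

Lemma submod_pred_closed : submod_closed (submod_pred subP).
Proof.
split=> [|a u v]; first by apply/submod_predP; exact: subP.1.
by move=> /submod_predP Pu /submod_predP Pv; apply/submod_predP; exact: subP.2.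
Qed.

HB.instance Definition _ := GRing.isSubmodClosed.Build R V (submod_pred subP)
  submod_pred_closed.

Record submod_type := Submod { submod_val : V; _ : submod_val \in submod_pred subP }.
HB.instance Definition _ := [isSub for submod_val].
HB.instance Definition _ := [Choice of submod_type by <:].
HB.instance Definition _ := [SubChoice_isSubLmodule of submod_type by <:].

Definition quot_type : Type := (Quotient.quot (submod_pred subP : zmodClosed V)).
HB.instance Definition _ := GRing.Zmodule.on quot_type.

Local Open Scope quotient_scope.
Definition quot_proj (v : V) : quot_type :=
  \pi_(Quotient.quot (submod_pred subP : zmodClosed V)) v.
Definition quot_repr (x : quot_type) : V :=
  repr (x : (Quotient.quot (submod_pred subP : zmodClosed V))).

Lemma quot_reprK x : quot_proj (quot_repr x) = x.
Proof. exact: reprK. Qed.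

Lemma quot_proj_eq u v : quot_proj u = quot_proj v <-> P (u - v).
Proof.
split=> [/eqP|Puv]; last apply/eqP.
  by rewrite -Quotient.idealrBE => /submod_predP.
by rewrite -Quotient.idealrBE; apply/submod_predP.
Qed.

Lemma quot_projD u v : quot_proj (u + v) = quot_proj u + quot_proj v.
Proof. exact: raddfD. Qed.

Definition quot_scale a (x : quot_type) : quot_type := quot_proj (a *: quot_repr x).

Lemma quot_projZ a u : quot_scale a (quot_proj u) = quot_proj (a *: u).
Proof.
apply/quot_proj_eq; rewrite -scalerBr -[_ *: _]addr0.
apply: subP.2 subP.1; apply/quot_proj_eq; exact: quot_reprK.
Qed.

Fact quot_scaleA a b x : quot_scale a (quot_scale b x) = quot_scale (a * b) x.
Proof. by rewrite -[x]quot_reprK !quot_projZ scalerA. Qed.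
Fact quot_scale1 : left_id 1 quot_scale.
Proof. by move=> x; rewrite -[x]quot_reprK quot_projZ scale1r. Qed.
Fact quot_scaleDr : right_distributive quot_scale +%R.
Proof.
move=> a x y; rewrite -[x]quot_reprK -[y]quot_reprK -quot_projD !quot_projZ.
by rewrite -quot_projD scalerDr.
Qed.
Fact quot_scaleDl x : {morph quot_scale^~ x : a b / a + b}.
Proof.
by move=> a b; rewrite -[x]quot_reprK !quot_projZ scalerDl quot_projD.
Qed.
HB.instance Definition _ := GRing.Zmodule_isLmodule.Build R quot_type
  quot_scaleA quot_scale1 quot_scaleDr quot_scaleDl.

Lemma quot_proj_linear : linear quot_proj.
Proof. by move=> a u v; rewrite quot_projD -quot_projZ. Qed.

Lemma submodule_ex : exists (S : lmodType R) (i : {linear S -> V}),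
  injective i /\ forall v, P v <-> exists s, i s = v.
Proof.
exists submod_type, (val : {linear submod_type -> V}); split; first exact: val_inj.
move=> v; split=> [Pv|[s <-]]; last by apply/submod_predP; exact: (valP s).
have pv : v \in submod_pred subP by apply/submod_predP.
by exists (Submod pv).
Qed.

Lemma quotient_ex : exists (Q : lmodType R) (q : {linear V -> Q}),
  (forall x, exists v, q v = x) /\ forall v, q v = 0 <-> P v.
Proof.
exists quot_type, (mklin quot_proj_linear); split=> [x|v].
  by exists (quot_repr x); exact: quot_reprK.
rewrite -[in P v](subr0 v) -quot_proj_eq /=.
suff -> : quot_proj 0 = 0 by [].
exact: raddf0.
Qed.

End SubQuotient.
End LinearMaps.

(** * Coordinates over the ground field *)

Section Coordinates.
Variables (k : fieldType) (A : falgType k).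

(** A copy of the type [X] to carry its structure of vector space over [k], as
    [X] is already a module over another ring. *)
Definition kres (X : lmodType A^c) : Type := X.

Section KRes.
Variable X : lmodType A^c.
HB.instance Definition _ := GRing.Zmodule.on (kres X).
Definition kscale (c : k) (x : kres X) : kres X := ((c%:A : A) : A^c) *: (x : X).
Fact kscaleA a b x : kscale a (kscale b x) = kscale (a * b) x.
Proof.
rewrite /kscale scalerA; congr (_ *: _).
by rewrite [LHS](_ : _ = (b%:A : A) * a%:A) // -scalerAl mul1r scalerA mulrC.
Qed.
Fact kscale1 : left_id 1 kscale.
Proof. by move=> x; rewrite /kscale [_%:A]scale1r scale1r. Qed.
Fact kscaleDr : right_distributive kscale +%R.
Proof. by move=> a x y; rewrite /kscale; exact: scalerDr. Qed.
Fact kscaleDl x : {morph kscale^~ x : a b / a + b}.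
Proof. by move=> a b; rewrite /kscale [_%:A]scalerDl; exact: scalerDl. Qed.
HB.instance Definition _ := GRing.Zmodule_isLmodule.Build k (kres X)
  kscaleA kscale1 kscaleDr kscaleDl.
Lemma kscale_scale (c : k) (a : A) (x : X) :
  c *: ((a : A^c) *: x : kres X) = ((c *: a : A) : A^c) *: x.
Proof.
rewrite [LHS](scalerA (c%:A : A^c) (a : A^c) x).
have -> // : (c%:A : A^c) * (a : A^c) = (c *: a : A).
by rewrite [LHS](_ : _ = a * c%:A) // -scalerAr mulr1.
Qed.
End KRes.

Lemma kres_linear (X Y : lmodType A^c) (f : {linear X -> Y}) :
  linear (f : kres X -> kres Y).
Proof. by move=> a x y; exact: linearP. Qed.
Definition kmap (X Y : lmodType A^c) (f : {linear X -> Y}) :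
  {linear kres X -> kres Y} := mklin (kres_linear f).

(** Take a matrix of maximal rank among those whose rows lie in [W]. *)
Lemma subspace_rows n (W : 'rV[k]_n -> Prop) : submodule W ->
  exists B : 'M[k]_n, forall v, W v <-> (v <= B)%MS.
Proof.
move=> [W0 WD].
pose Q m := `[< exists B : 'M[k]_n,
  (forall v : 'rV_n, (v <= B)%MS -> W v) /\ \rank B = m >].
have exQ : exists m, Q m.
  exists 0%N; apply/asboolP; exists 0; rewrite mxrank0; split=> // v.
  by rewrite submx0 => /eqP ->.
have ubQ m : Q m -> (m <= n)%N.
  by move=> /asboolP [B [_ <-]]; exact: rank_leq_row.
case: (ex_maxnP exQ ubQ) => m /asboolP [B [BW rB]] maxm.
exists B => v; split=> [Wv|]; last exact: BW.
apply: contraT => vB.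
have: (\rank (B + v)%MS <= m)%N.
  apply: maxm; apply/asboolP; exists (B + v)%MS; split=> // u.
  move=> /sub_addsmxP [[u1 u2] /= ->]; rewrite addrC [u2]mx11_scalar mul_scalar_mx.
  by apply: WD => //; apply: BW; exact: submxMl.
have: (B < B + v)%MS.
  by rewrite ltmxE addsmxSl /= addsmx_sub submx_refl.
by rewrite -rB => /rank_ltmx; rewrite ltnNge => /negP.
Qed.

Definition kdim (X : lmodType A^c) (n : nat) : Prop :=
  exists r : {linear 'rV[k]_n -> kres X}, bijective r.

Lemma kspan_ex (X : lmodType A^c) : finitely_generated X ->
  exists n (r : {linear 'rV[k]_n -> kres X}), forall x, exists u, r u = x.
Proof.
move=> [m [x gen]].
pose g (a : {ffun 'I_m -> A}) : kres X := \sum_(i < m) (a i : A^c) *: x i.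
have lin_g : linear g.
  move=> c a b; rewrite /g scaler_sumr -big_split /=; apply: eq_bigr => i _.
  by rewrite kscale_scale !ffunE;
    exact: (@scalerDl A^c X (x i) (c *: (a i : A) : A) (b i)).
exists (dim {ffun 'I_m -> A}).
have lin_r : linear (fun u => g (r2v u)).
  by move=> c u v; rewrite linearP; exact: lin_g.
exists (mklin lin_r) => y; have [a ->] := gen y.
exists (v2r [ffun i => a i : A]); rewrite /= v2rK /g.
by apply: eq_bigr => i _; rewrite ffunE.
Qed.

(** A spanning family of minimal length is a basis: in a linear relation with a
    nonzero coefficient at [i], the [i]-th vector is redundant. *)
Lemma kdim_ex (X : lmodType A^c) : finitely_generated X -> exists n, kdim X n.
Proof.
move=> /kspan_ex exX.
pose Q n := `[< exists r : {linear 'rV[k]_n -> kres X}, forall x, exists u, r u = x >].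
have exQ : exists n, Q n by have [n exr] := exX; exists n; exact/asboolP.
case: (ex_minnP exQ) => n /asboolP [r surj_r] min_n.
exists n, r.
suff inj_r : injective r.
  have /choice [s rs] := surj_r.
  by exists s => u; [apply: inj_r; rewrite rs | rewrite rs].
apply/raddf_inj => v rv0; apply/rowP => i; move: i.
case: n => [|n] in r surj_r min_n v rv0 *; first by case.
move=> i; rewrite mxE; apply: contraFeq (ltnn n) => vi.
apply: min_n; apply/asboolP.
(* The map [e] inserts a zero in position [i]; modulo multiples of [v], every
   vector is in its image. *)
pose e (u : 'rV[k]_n) : 'rV[k]_n.+1 :=
  \row_j (if unlift i j is Some j' then u 0 j' else 0).
have lin_e : linear e.
  move=> c u w; apply/rowP => j; rewrite !mxE.
  by case: (unlift i j) => [j'|]; rewrite ?mxE // mulr0 addr0.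
exists (lcomp r (mklin lin_e)) => x; have [w rw] := surj_r x.
pose w' := w - (w 0 i / v 0 i) *: v.
exists (\row_j w' 0 (lift i j)); rewrite /= -rw.
have -> : w = w' + (w 0 i / v 0 i) *: v by rewrite subrK.
rewrite linearD linearZ /= rv0 scaler0 addr0; congr (r _).
apply/rowP => j; rewrite mxE; case: unliftP => [j' -> |->]; rewrite ?mxE //.
by rewrite divfK // subrr.
Qed.

Lemma fg_surj (X Y : lmodType A^c) (f : {linear X -> Y}) :
  finitely_generated X -> (forall y, exists x, f x = y) -> finitely_generated Y.
Proof.
move=> [n [x gen]] surj_f; exists n, (fun i => f (x i)) => y.
have [x' <-] := surj_f y; have [a ->] := gen x'; exists a.
by rewrite linear_sum; apply: eq_bigr => i _; rewrite linearZ.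
Qed.

(** Modules over a finite-dimensional algebra are Noetherian, because a
    submodule is a subspace of a finite-dimensional vector space. *)
Lemma fg_inj (X Y : lmodType A^c) (f : {linear X -> Y}) :
  finitely_generated Y -> injective f -> finitely_generated X.
Proof.
move=> /kspan_ex [n [r surj_r]] inj_f.
have [|B WB] := @subspace_rows n (fun v => exists x, kmap f x = r v).
  split=> [|a u v [x fx] [y fy]]; first by exists 0; rewrite !linear0.
  by exists (a *: x + y); rewrite !linearP fx fy.
have /choice [x fx] : forall i, exists x, kmap f x = r (row i B).
  by move=> i; apply/WB; exact: row_sub.
exists n, x => y; have [v rv] := surj_r (f y).
have /WB/submxP [D vD] : exists x, kmap f x = r v by exists y.
exists (fun i => (D 0 i)%:A : A); apply: inj_f.
rewrite -rv vD mulmx_sum_row !linear_sum; apply: eq_bigr => i _.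
by rewrite !linearZ /= -fx.
Qed.

(** Makes the choice of an image of smallest dimension useful for finding left
    minimal maps. *)
Lemma kdim_surj (X Y : lmodType A^c) (f : {linear X -> Y}) n m :
  kdim X n -> kdim Y m -> (forall y, exists x, f x = y) ->
  ~ injective f -> (m < n)%N.
Proof.
move=> [r [r' rK r'K]] [s [s' sK s'K]] surj_f ninj_f.
have lin_s' : linear s'.
  by move=> a x y; apply: (can_inj sK); rewrite linearP !s'K.
pose F := lin1_mx (lcomp (mklin lin_s') (lcomp (kmap f) r)).
have FE u : s (u *m F) = f (r u) by rewrite mul_rV_lin1 /= s'K.
have fullF : row_full F.
  rewrite -sub1mx; apply/row_subP => i.
  have [x fx] := surj_f (s (row i 1%:M)); apply/submxP; exists (r' x).
  by apply: (can_inj sK); rewrite FE r'K fx.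
have := rank_leq_row F; rewrite leq_eqVlt (eqP fullF) => /orP [/eqP mn|//].
case: ninj_f; have freeF : row_free F by rewrite /row_free (eqP fullF) mn.
move=> x y fxy; rewrite -[x]r'K -[y]r'K; congr (r _).
by apply: (row_free_inj freeF); apply: (can_inj sK); rewrite !FE !r'K.
Qed.

Lemma inj_endo_bij (X : lmodType A^c) (f : {linear X -> X}) :
  finitely_generated X -> injective f -> bijective f.
Proof.
move=> /kdim_ex [n [r [r' rK r'K]]] inj_f.
have lin_r' : linear r'.
  by move=> a x y; apply: (can_inj rK); rewrite linearP !r'K.
pose F := lin1_mx (lcomp (mklin lin_r') (lcomp (kmap f) r)).
have FE u : r (u *m F) = f (r u) by rewrite mul_rV_lin1 /= r'K.
have freeF : row_free F.
  rewrite -kermx_eq0; apply/eqP/row_matrixP => i; rewrite row0.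
  apply: (can_inj rK); apply: inj_f; rewrite -FE linear0 linear0.
  by rewrite -row_mul mulmx_ker row0 linear0.
have unitF : F \in unitmx by rewrite -row_free_unit.
have surj_f y : exists x, f x = y.
  by exists (r (r' y *m invmx F)); rewrite -FE mulmxKV // r'K.
have /choice [g fg] := surj_f.
by exists g => x; [apply: inj_f; rewrite fg | rewrite fg].
Qed.

(** Linear maps defined on a submodule extend over [k]: compose them with a
    generalised inverse of the inclusion. *)
Lemma ginverse_ex (X Y : lmodType A^c) (q : {linear X -> Y}) :
  finitely_generated X -> finitely_generated Y ->
  exists s : {linear kres Y -> kres X}, forall x, q (s (q x)) = q x.
Proof.
move=> /kdim_ex [n [r [r' rK r'K]]] /kdim_ex [m [t [t' tK t'K]]].
have lin_t' : linear t'.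
  by move=> a x y; apply: (can_inj tK); rewrite linearP !t'K.
pose F := lin1_mx (lcomp (mklin lin_t') (lcomp (kmap q) r)).
have FE u : t (u *m F) = q (r u) by rewrite mul_rV_lin1 /= t'K.
have lin_s : linear (fun y => r (t' y *m pinvmx F)).
  by move=> a x y; rewrite lin_t' mulmxDl -scalemxAl linearP.
exists (mklin lin_s) => x /=.
have qx : t' (q x) = r' x *m F.
  by apply: (can_inj tK); rewrite t'K FE r'K.
by rewrite qx -FE mulmxKpV ?submxMl // FE r'K.
Qed.

End Coordinates.

(** * Finitely generated modules *)

Section Modules.
Variables (k : fieldType) (A : falgType k).
Implicit Types W X Y Z K C N L E P Q : fgmod A.

Definition ses X Y Z (a : {linear X -> Y}) (b : {linear Y -> Z}) : Prop :=
  [/\ injective a, exact a b & surj b].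

Lemma exact0 X Y Z (a : {linear X -> Y}) (b : {linear Y -> Z}) x :
  exact a b -> b (a x) = 0.
Proof. by move=> ab; apply/ab; exists x. Qed.

Lemma exact_lift X Y Z W (a : {linear X -> Y}) (b : {linear Y -> Z})
    (f : {linear W -> Y}) :
  injective a -> exact a b -> (forall w, b (f w) = 0) ->
  exists g : {linear W -> X}, forall w, a (g w) = f w.
Proof. by move=> inj_a ab bf; apply: factor_inj => // w; apply/ab. Qed.

Lemma exact_desc X Y Z W (a : {linear X -> Y}) (b : {linear Y -> Z})
    (f : {linear Y -> W}) :
  exact a b -> surj b -> (forall x, f (a x) = 0) ->
  exists g : {linear Z -> W}, forall y, g (b y) = f y.
Proof.
by move=> ab surj_b fa; apply: factor_surj => // y /ab [x <-].
Qed.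

Lemma fgsub_ex X (S : X -> Prop) : submodule S ->
  exists Y (i : {linear Y -> X}), injective i /\ forall x, S x <-> exists y, i y = x.
Proof.
move=> /submodule_ex [Y [i [inj_i im_i]]].
by exists (FgMod (fg_inj (fgmod_fg X) inj_i)), i.
Qed.

Lemma ker_ex X Y (f : {linear X -> Y}) :
  exists K (i : {linear K -> X}), injective i /\ exact i f.
Proof.
have [|K [i [inj_i im_i]]] := @fgsub_ex X (fun x => f x = 0).
  by split=> [|a u v fu fv]; rewrite ?linear0 // linearP fu fv scaler0 addr0.
by exists K, i.
Qed.

Lemma fgquot_ex X (S : X -> Prop) : submodule S ->
  exists Y (q : {linear X -> Y}), surj q /\ forall x, q x = 0 <-> S x.
Proof.
move=> /quotient_ex [Y [q [surj_q ker_q]]].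
by exists (FgMod (fg_surj (fgmod_fg X) surj_q)), q.
Qed.

Lemma image_submodule X Y (f : {linear X -> Y}) :
  submodule (fun y => exists x, f x = y).
Proof.
split=> [|a _ _ [u <-] [v <-]]; first by exists 0; rewrite linear0.
by exists (a *: u + v); rewrite linearP.
Qed.

Lemma coker_ex X Y (f : {linear X -> Y}) :
  exists C (q : {linear Y -> C}), exact f q /\ surj q.
Proof.
have [C [q [surj_q ker_q]]] := fgquot_ex (image_submodule f).
by exists C, q.
Qed.

Lemma mono_ses X Y (f : {linear X -> Y}) : injective f ->
  exists C (q : {linear Y -> C}), ses f q.
Proof. by move=> inj_f; have [C [q [fq sq]]] := coker_ex f; exists C, q. Qed.

Lemma epi_ses X Y (f : {linear X -> Y}) : surj f ->
  exists K (i : {linear K -> X}), ses i f.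
Proof. by move=> surj_f; have [K [i [ii ie]]] := ker_ex f; exists K, i. Qed.

Lemma fg_free n : finitely_generated 'rV[A^c]_n.
Proof.
exists n, (fun i => delta_mx 0 i) => y; exists (y 0).
exact: row_sum_delta.
Qed.
Definition fgfree n : fgmod A := FgMod (fg_free n).

Lemma fgfree_rec n X (x : 'I_n -> X) :
  exists f : {linear fgfree n -> X}, forall u, f u = \sum_(i < n) u 0 i *: x i.
Proof.
have lin_f : linear (fun u : fgfree n => \sum_(i < n) u 0 i *: x i).
  move=> a u v; rewrite scaler_sumr -big_split; apply: eq_bigr => i _.
  by rewrite !mxE scalerDl scalerA.
by exists (mklin lin_f).
Qed.

Lemma projective_free n : projective (fgfree n).
Proof.
move=> X Y e g surj_e.
have /choice [x ex] : forall i, exists x, e x = g (delta_mx 0 i).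
  by move=> i; exact: surj_e.
have [h hE] := fgfree_rec x; exists h => u.
rewrite hE [in RHS](row_sum_delta u) !linear_sum.
by apply: eq_bigr => i _; rewrite !linearZ /= ex.
Qed.

Lemma free_cover X : exists n (e : {linear fgfree n -> X}), surj e.
Proof.
have [n [x gen]] := fgmod_fg X; have [e eE] := fgfree_rec x.
exists n, e => y; have [a ->] := gen y; exists (\row_i a i).
by rewrite eE; apply: eq_bigr => i _; rewrite mxE.
Qed.

Lemma presentation_ex X : exists K P (a : {linear K -> P}) (b : {linear P -> X}),
  projective P /\ ses a b.
Proof.
have [n [b surj_b]] := free_cover X; have [K [a ab]] := epi_ses surj_b.
by exists K, (fgfree n), a, b; split=> //; exact: projective_free.
Qed.

Lemma fg_prod X Y : finitely_generated (X * Y)%type.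
Proof.
have [n [e surj_e]] := free_cover X; have [m [f surj_f]] := free_cover Y.
have lin_g : linear (fun u : fgfree (n + m) => (e (lsubmx u), f (rsubmx u))).
  by move=> a u v; rewrite !linearP.
apply: (fg_surj (f := mklin lin_g) (fgmod_fg _)) => -[x y].
have [u <-] := surj_e x; have [v <-] := surj_f y.
by exists (row_mx u v); rewrite /= row_mxKl row_mxKr.
Qed.
Definition fgprod X Y : fgmod A := FgMod (fg_prod X Y).

Lemma zero_ex : exists Z, forall z : Z, z = 0.
Proof. by exists (fgfree 0) => z; apply/rowP; case. Qed.

Lemma projective_zero Z : (forall z : Z, z = 0) -> projective Z.
Proof.
move=> Z0 X Y e g _; exists (lzero Z X) => z.
by rewrite (Z0 z) !linear0.
Qed.

Lemma projective_prod P Q : projective P -> projective Q -> projective (fgprod P Q).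
Proof.
move=> pP pQ X Y e g surj_e.
have [h1 h1E] := pP _ _ e (lcomp g (lpair (lid P) (lzero P Q))) surj_e.
have [h2 h2E] := pQ _ _ e (lcomp g (lpair (lzero Q P) (lid Q))) surj_e.
exists (ladd (lcomp h1 (lfst P Q)) (lcomp h2 (lsnd P Q))) => -[x y] /=.
rewrite linearD h1E h2E /= -linearD; congr (g _).
by rewrite -[LHS]/(x + 0, 0 + y) addr0 add0r.
Qed.

End Modules.

(** * Vanishing of Ext by dimension shifting *)

Section Ext.
Variables (k : fieldType) (A : falgType k).
Implicit Types W X Y Z K C N L E P Q D : fgmod A.

(** The condition Ext^(n+1)(C, N) = 0, by dimension shifting. For n = 0 the
    sequences may have any middle term, which is convenient for pullbacks; the
    inductive step replaces [C] by any of its syzygies. *)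
Fixpoint ext_zero (n : nat) (C N : fgmod A) : Prop :=
  match n with
  | 0 => forall K X (a : {linear K -> X}) (b : {linear X -> C}), ses a b ->
           forall u : {linear K -> N}, exists v : {linear X -> N},
             forall x, v (a x) = u x
  | m.+1 => forall K P (a : {linear K -> P}) (b : {linear P -> C}),
              projective P -> ses a b -> ext_zero m K N
  end.

Lemma projective_summand L Q P (a : {linear L -> Q}) (b : {linear Q -> P}) :
  projective Q -> projective P -> ses a b -> projective L.
Proof.
move=> pQ pP [inj_a ab surj_b].
have [s bs] := pP _ _ b (lid P) surj_b.
have [r ar] : exists r : {linear Q -> L}, forall q, a (r q) = q - s (b q).
  apply: (exact_lift (f := lsub (lid Q) (lcomp s b)) inj_a ab) => q /=.
  by rewrite linearB bs subrr.
have ra x : r (a x) = x.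
  by apply: inj_a; rewrite ar (exact0 _ ab) linear0 subr0.
move=> X Y e g surj_e; have [h eh] := pQ _ _ e (lcomp g r) surj_e.
by exists (lcomp h a) => x; rewrite /= eh /= ra.
Qed.

Lemma ext_zero_projective n P N : projective P -> ext_zero n P N.
Proof.
elim: n P => [|n IHn] P pP /= K X a b; last first.
  by move=> pX ab; apply: IHn; exact: (projective_summand pX pP ab).
move=> [inj_a ab surj_b] u.
have [s bs] := pP _ _ b (lid P) surj_b.
have [r ar] : exists r : {linear X -> K}, forall q, a (r q) = q - s (b q).
  apply: (exact_lift (f := lsub (lid X) (lcomp s b)) inj_a ab) => q /=.
  by rewrite linearB bs subrr.
exists (lcomp u r) => x /=; congr (u _); apply: inj_a.
by rewrite ar (exact0 _ ab) linear0 subr0.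
Qed.

Lemma ses_prod L E K P (a : {linear L -> E}) (b : {linear E -> K}) : ses a b ->
  ses (lpair a (lzero L P) : {linear L -> fgprod E P})
      (lpair (lcomp b (lfst E P)) (lsnd E P) : {linear fgprod E P -> fgprod K P}).
Proof.
move=> [inj_a ab surj_b]; split=> [x y [] /inj_a //|[x y]|[x y]].
  split=> [[bx y0]|[l [<- <-]]]; last by rewrite /= (exact0 _ ab).
  have [l <-] := (ab x).1 bx; exists l; apply/pair_equal_spec.
  by split=> //; exact: esym.
by have [z <-] := surj_b x; exists (z, y).
Qed.

Lemma ext_zero_prodl n K P N :
  projective P -> ext_zero n (fgprod K P) N -> ext_zero n K N.
Proof.
move=> pP; case: n => [|n] /= extKP L E a b.
  move=> /(ses_prod P) /extKP extE u; have [v va] := extE u.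
  by exists (lcomp v (lpair (lid E) (lzero E P))) => x; rewrite -va.
by move=> pE /(ses_prod P); apply: extKP; exact: projective_prod.
Qed.

(** The preimage [D] of the submodule [K] under an epimorphism [E -> X] is
    again an extension of [K] by the kernel of that epimorphism. *)
Lemma ses_pull X Y C D K L E (a : {linear K -> X}) (b : {linear X -> C})
    (l : {linear L -> E}) (q : {linear E -> X}) (i : {linear D -> E}) :
  ses a b -> ses l q -> ses i (lcomp b q) ->
  exists (j : {linear L -> D}) (t : {linear D -> K}),
    [/\ ses j t, forall x, i (j x) = l x & forall d, a (t d) = q (i d)].
Proof.
move=> [inj_a ab surj_b] [inj_l lq surj_q] [inj_i ibq _].
have [j ij] : exists j : {linear L -> D}, forall x, i (j x) = l x.
  by apply: (exact_lift inj_i ibq) => x; rewrite /= (exact0 _ lq) linear0.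
have [t at_] : exists t : {linear D -> K}, forall d, a (t d) = q (i d).
  by apply: (exact_lift (f := lcomp q i) inj_a ab) => d; exact: (exact0 d ibq).
exists j, t; split=> //; split.
- by move=> x y jxy; apply: inj_l; rewrite -!ij jxy.
- move=> d; split=> [td|[x <-]]; last first.
    by apply: inj_a; rewrite at_ ij (exact0 _ lq) linear0.
  have /lq [x lx] : q (i d) = 0 by rewrite -at_ td linear0.
  by exists x; apply: inj_i; rewrite ij.
- move=> y; have [e qe] := surj_q (a y).
  have /ibq [d id_] : lcomp b q e = 0 by rewrite /= qe (exact0 _ ab).
  by exists d; apply: inj_a; rewrite at_ id_.
Qed.

Lemma surj_comp X Y Z (f : {linear Y -> Z}) (g : {linear X -> Y}) :
  surj f -> surj g -> surj (lcomp f g).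
Proof.
by move=> sf sg z; have [y <-] := sf z; have [x <-] := sg y; exists x.
Qed.

Lemma fgprod_ext X Y (z z' : (X * Y)%type) : z.1 = z'.1 -> z.2 = z'.2 -> z = z'.
Proof. by case: z z' => [x y] [x' y'] /= -> ->. Qed.

(** Rotation of a short exact sequence [K -> X -> C]: if [L] is the kernel of an
    epimorphism [P -> C] from a projective module, then [L -> K + P -> X] is exact. *)
Lemma ses_rotate K X C P (a : {linear K -> X}) (b : {linear X -> C})
    (e : {linear P -> C}) :
  ses a b -> projective P -> surj e ->
  exists L (l : {linear L -> P}) (j : {linear L -> fgprod K P})
    (t : {linear fgprod K P -> X}), ses l e /\ ses j t.
Proof.
move=> [inj_a ab surj_b] pP surj_e.
have [f bf] := pP _ _ b e surj_b.
pose t : {linear fgprod K P -> X} := ladd (lcomp a (lfst K P)) (lcomp f (lsnd K P)).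
have surj_t : surj t.
  move=> x; have [p ep] := surj_e (b x).
  have /ab [y ay] : b (x - f p) = 0 by rewrite linearB bf ep subrr.
  by exists (y, p); rewrite /= ay subrK.
have [L [j jt]] := epi_ses surj_t; have [inj_j ejt _] := jt.
have jE z : a (j z).1 + f (j z).2 = 0 by exact: (exact0 z ejt).
exists L, (lcomp (lsnd K P) j), j, t; split=> //; split=> //.
- move=> x y /= jxy; apply: inj_j; apply: fgprod_ext => //.
  apply: inj_a; apply: (addIr (f (j x).2)).
  by rewrite jE jxy jE.
- move=> p; split=> [ep|[z <-]] /=.
    have /ab [y ay] : b (- f p) = 0 by rewrite linearN bf ep oppr0.
    have /ejt [z jz] : t (y, p) = 0 by rewrite /= ay addNr.
    by exists z; rewrite jz.
  by rewrite -bf -[f _](addKr (a (j z).1)) jE addr0 linearN (exact0 _ ab) oppr0.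
Qed.

(** Two pieces of the long exact sequence in the first argument of Ext. In a
    given degree the second one is the first one for the rotated sequence, and
    it yields the first one in the next degree: a syzygy of [X] is the kernel
    of an epimorphism from a syzygy of [C] to [K]. *)
Lemma ext_les n N K X C (a : {linear K -> X}) (b : {linear X -> C}) : ses a b ->
  (ext_zero n K N -> ext_zero n C N -> ext_zero n X N) /\
  (ext_zero n X N -> ext_zero n.+1 C N -> ext_zero n K N).
Proof.
have step m : (forall K X C (a : {linear K -> X}) (b : {linear X -> C}), ses a b ->
    ext_zero m K N -> ext_zero m C N -> ext_zero m X N) ->
  forall K X C (a : {linear K -> X}) (b : {linear X -> C}), ses a b ->
    ext_zero m X N -> ext_zero m.+1 C N -> ext_zero m K N.
  move=> mid K0 X0 C0 a0 b0 ab0 extX extC.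
  have [_ [P [_ [e [pP [_ _ surj_e]]]]]] := presentation_ex C0.
  have [L [l [j [t [le jt]]]]] := ses_rotate ab0 pP surj_e.
  exact: ext_zero_prodl pP (mid _ _ _ _ _ jt (extC _ _ _ _ pP le) extX).
have mid : forall m K X C (a : {linear K -> X}) (b : {linear X -> C}), ses a b ->
    ext_zero m K N -> ext_zero m C N -> ext_zero m X N.
  elim=> [|m IHm] K0 X0 C0 a0 b0 ab0 extK extC L E l q.
    move=> lq u; have [_ _ sb] := ab0; have [_ _ sq] := lq.
    have [D [i ibq]] := epi_ses (surj_comp sb sq).
    have [j [t [jt ij _]]] := ses_pull C0 ab0 lq ibq.
    have [v vj] := extK _ _ _ _ jt u; have [w wi] := extC _ _ _ _ ibq v.
    by exists w => x; rewrite -ij wi vj.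
  move=> pE lq; have [_ _ sb] := ab0; have [_ _ sq] := lq.
  have [D [i ibq]] := epi_ses (surj_comp sb sq).
  have [j [t [jt ij _]]] := ses_pull C0 ab0 lq ibq.
  apply: (step m IHm _ _ _ _ _ jt) => //.
  exact: extC pE ibq.
by move=> ab; split; [exact: mid ab | exact: step (mid n) _ _ _ _ _ ab].
Qed.

(** The third piece of the long exact sequence: a syzygy [L] of [C] is the
    kernel of an epimorphism [K + P -> X]. *)
Lemma ext_les_coker n N K X C (a : {linear K -> X}) (b : {linear X -> C}) :
  ses a b -> ext_zero n K N -> ext_zero n.+1 X N -> ext_zero n.+1 C N.
Proof.
move=> ab extK extX L P l e pP le.
have [inj_a eab surj_b] := ab; have [inj_l ele surj_e] := le.
have [f bf] := pP _ _ b e surj_b.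
have [c ac] : exists c : {linear L -> K}, forall z, a (c z) = - f (l z).
  apply: (exact_lift (f := lopp (lcomp f l)) inj_a eab) => z /=.
  by rewrite linearN bf (exact0 _ ele) oppr0.
pose j : {linear L -> fgprod K P} := lpair c l.
pose t : {linear fgprod K P -> X} := ladd (lcomp a (lfst K P)) (lcomp f (lsnd K P)).
have jt : ses j t.
  split=> [x y [_ /inj_l //]|[y p]|x].
    split=> [tyz|[z [<- <-]]]; last by rewrite /= ac addNr.
    have fp : f p = - a y by apply/eqP; rewrite -addr_eq0 addrC; exact/eqP.
    have /ele [z lz] : e p = 0 by rewrite -bf fp linearN (exact0 _ eab) oppr0.
    exists z; apply/pair_equal_spec; split=> //.
    by apply: inj_a; rewrite ac lz fp opprK.
  have [p ep] := surj_e (b x).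
  have /eab [y ay] : b (x - f p) = 0 by rewrite linearB bf ep subrr.
  by exists (y, p); rewrite /= ay subrK.
apply: (proj2 (ext_les n N jt)) => //.
have pk : ses (lpair (lzero P K) (lid P) : {linear P -> fgprod K P})
    (lfst K P : {linear fgprod K P -> K}).
  split=> [x y [] //|[y p]|y]; last by exists (y, 0).
  by split=> [/= ->|[p' [<- _]] //]; exists p.
apply: (proj1 (ext_les n N pk)) => //; exact: ext_zero_projective.
Qed.

(** The beginning of the long exact sequence. An extension of [C] is pulled
    back to [X]; the extension to the pullback of a map to [N] is corrected by
    a map on [X] so that it descends. *)
Lemma ext_les_coker0 N K X C (a : {linear K -> X}) (b : {linear X -> C}) :
  ses a b ->
  (forall u : {linear K -> N}, exists v : {linear X -> N}, forall x, v (a x) = u x) ->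
  ext_zero 0 X N -> ext_zero 0 C N.
Proof.
move=> [inj_a ab surj_b] extK extX L E l q [inj_l lq surj_q] u.
pose d : {linear fgprod X E -> C} := lsub (lcomp b (lfst X E)) (lcomp q (lsnd X E)).
have [D [i [inj_i id_]]] := ker_ex d.
have iE z : b (i z).1 = q (i z).2 by apply/subr0_eq; exact: (exact0 z id_).
have [|j ij] := exact_lift (f := lpair (lzero L X) l : {linear L -> fgprod X E})
    inj_i id_.
  by move=> x; rewrite /= linear0 (exact0 _ lq) subr0.
have jt : ses j (lcomp (lfst X E) i : {linear D -> X}).
  split=> [x y jxy|z|x].
  - by apply: inj_l; have := ij x; rewrite jxy ij => -[].
  - split=> [/= z1|[x <-]]; last by rewrite /= ij.
    have /lq [x lx] : q (i z).2 = 0 by rewrite -iE z1 linear0.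
    by exists x; apply: inj_i; rewrite ij /= lx -z1; case: (i z).
  - have [y qy] := surj_q (b x).
    have /id_ [z iz] : d (x, y) = 0 by rewrite /= qy subrr.
    by exists z; rewrite /= iz.
have [w wj] := extX _ _ _ _ jt u.
have [|c ic] := exact_lift (f := lpair a (lzero K E) : {linear K -> fgprod X E})
    inj_i id_.
  by move=> x; rewrite /= (exact0 _ ab) linear0 subr0.
have [w' w'a] := extK (lcomp w c).
have ker_s : exact c (lcomp (lsnd X E) i).
  move=> z; split=> [/= z2|[x <-]]; last by rewrite /= ic.
  have /ab [x ax] : b (i z).1 = 0 by rewrite iE z2 linear0.
  by exists x; apply: inj_i; rewrite ic /= ax -z2; case: (i z).
have surj_s : surj (lcomp (lsnd X E) i).
  move=> y; have [x bx] := surj_b (q y).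
  have /id_ [z iz] : d (x, y) = 0 by rewrite /= bx subrr.
  by exists z; rewrite /= iz.
have [|v vs] := @exact_desc _ _ _ _ _ _ _ _
    (lsub w (lcomp w' (lcomp (lfst X E) i))) ker_s surj_s.
  by move=> x; rewrite /= ic w'a subrr.
exists v => x; have := vs (j x); rewrite /= ij /= => ->.
by rewrite linear0 subr0 wj.
Qed.

End Ext.

(** * Comparison with projective resolutions *)

Section Resolutions.
Variables (k : fieldType) (A : falgType k).
Implicit Types V W X Y Z K C N L E P Q D : fgmod A.

Definition cons_obj X0 (X : nat -> fgmod A) (i : nat) : fgmod A :=
  if i is j.+1 then X j else X0.

Definition cons_res P0 (P : nat -> fgmod A) (g : {linear P 0%N -> P0})
    (p : forall i, {linear P i.+1 -> P i}) (i : nat) :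
    {linear cons_obj P0 P i.+1 -> cons_obj P0 P i} :=
  match i with 0 => g | j.+1 => p j end.

(** A bundled presentation, so that one can be chosen for all modules at once
    when a resolution is constructed recursively. *)
Record presentation X := Presentation {
  pres_syz : fgmod A;
  pres_proj : fgmod A;
  pres_incl : {linear pres_syz -> pres_proj};
  pres_epi : {linear pres_proj -> X};
  pres_projective : projective pres_proj;
  pres_ses : ses pres_incl pres_epi }.

Lemma inj_eq0 X Y (a : {linear X -> Y}) x : injective a -> a x = 0 <-> x = 0.
Proof.
move=> inj_a; split=> [ax|->]; last exact: linear0.
by apply: inj_a; rewrite ax linear0.
Qed.

Lemma exact_epi V X Y Z (q : {linear V -> X}) (a : {linear X -> Y})
    (b : {linear Y -> Z}) : surj q -> exact a b -> exact (lcomp a q) b.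
Proof.
move=> surj_q ab y; rewrite ab; split=> [[x <-]|[x <-]]; last by exists (q x).
by have [z <-] := surj_q x; exists z.
Qed.

Lemma exact_mono X Y Z V (a : {linear X -> Y}) (b : {linear Y -> Z})
    (i : {linear Z -> V}) : injective i -> exact a b -> exact a (lcomp i b).
Proof. by move=> inj_i ab y; rewrite -ab; exact: (inj_eq0 (b y) inj_i). Qed.

Lemma resolution_ex X : exists (P : nat -> fgmod A)
  (p : forall i, {linear P i.+1 -> P i}) (e : {linear P 0%N -> X}),
  projective_resolution p e.
Proof.
have pres Y : presentation Y.
  suff /cid [] : exists p : presentation Y, True by [].
  by have [K [P [a [b [pP ab]]]]] := presentation_ex Y; exists (Presentation pP ab).
pose fix syz i := if i is j.+1 then pres_syz (pres (syz j)) else X.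
exists (fun i => pres_proj (pres (syz i))),
  (fun i => lcomp (pres_incl (pres (syz i))) (pres_epi (pres (syz i.+1)))),
  (pres_epi (pres X)).
have sesP i := pres_ses (pres (syz i)).
split=> [i|||i].
- exact: pres_projective.
- by have [] := sesP 0%N.
- by apply: exact_epi; [have [] := sesP 1%N | have [] := sesP 0%N].
- have [_ _ surj2] := sesP i.+2; have [_ exact1 _] := sesP i.+1.
  by have [inj0 _ _] := sesP i; exact/exact_mono/exact_epi.
Qed.

Lemma cons_resolution X K P0 (P : nat -> fgmod A) (p : forall i, {linear P i.+1 -> P i})
    (e : {linear P 0%N -> K}) (a : {linear K -> P0}) (b : {linear P0 -> X}) :
  projective P0 -> ses a b -> projective_resolution p e ->
  projective_resolution (cons_res (lcomp a e) p) (b : {linear cons_obj P0 P 0 -> X}).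
Proof.
move=> pP0 [inj_a ab surj_b] [pP surj_e pe pp]; split=> //.
- by case.
- exact: exact_epi.
- by case=> [|i]; [exact: exact_mono | exact: pp].
Qed.

Lemma tail_resolution X K (P : nat -> fgmod A) (p : forall i, {linear P i.+1 -> P i})
    (e : {linear P 0%N -> X}) (a : {linear K -> P 0%N}) :
  projective_resolution p e -> ses a e ->
  exists q : {linear P 1%N -> K}, (forall x, a (q x) = p 0%N x) /\
    projective_resolution (fun i => p i.+1) q.
Proof.
move=> [pP surj_e pe pp] [inj_a ae _].
have [|q aq] := exact_lift (f := p 0%N) inj_a ae; first by move=> x; apply: exact0 pe.
exists q; split=> //; split=> // [x|x].
  have /pe [y py] : e (a x) = 0 by exact: exact0 ae.
  by exists y; apply: inj_a; rewrite aq.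
by rewrite -(pp 0%N x) -aq (inj_eq0 _ inj_a).
Qed.

(** A syzygy is resolved by the tail of a resolution, and conversely a
    resolution of a syzygy extends to one of the module, so that only degree
    one requires an argument: a 1-cocycle on a resolution of [C] is a map on
    the first syzygy. *)
Lemma Ext_vanishesP n C N : Ext_vanishes n.+1 C N <-> ext_zero n C N.
Proof.
elim: n C => [|n IHn] C; split.
- move=> extC K X a b [inj_a ab surj_b] u.
  have [P [p [e res]]] := resolution_ex C; have [pP surj_e pe pp] := res.
  have [f bf] := pP 0%N _ _ b e surj_b.
  have [|g ag] := exact_lift (f := lcomp f (p 0%N)) inj_a ab.
    by move=> x; rewrite /= bf (exact0 _ pe).
  have [|h hp] := extC P p e res (lcomp u g).
    move=> x /=; rewrite -[RHS](linear0 u); congr (u _); apply: inj_a.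
    by rewrite ag /= (exact0 _ (pp 0%N)) !linear0.
  pose w : {linear fgprod K (P 0%N) -> N} :=
    ladd (lcomp u (lfst K (P 0%N))) (lcomp h (lsnd K (P 0%N))).
  pose t : {linear fgprod K (P 0%N) -> X} :=
    ladd (lcomp a (lfst K (P 0%N))) (lcomp f (lsnd K (P 0%N))).
  have [||v vt] := factor_surj (q := t) (f := w).
  + move=> x; have [y ey] := surj_e (b x).
    have /ab [z az] : b (x - f y) = 0 by rewrite linearB bf ey subrr.
    by exists (z, y); rewrite /= az subrK.
  + move=> [y z] /= tyz; have ay : a y = - f z by apply/eqP; rewrite -addr_eq0 tyz.
    have /pe [x px] : e z = 0.
      by rewrite -bf -[f z]opprK -ay linearN (exact0 _ ab) oppr0.
    have -> : y = - g x by apply: inj_a; rewrite linearN ag /= px ay.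
    by rewrite -px hp /= linearN addNr.
  exists v => x; have := vt (x, 0); rewrite /= !linear0 !addr0; exact.
- move=> extC P p e res g cg; have [pP surj_e pe pp] := res.
  have [K [a ae]] := epi_ses surj_e.
  have [q [aq [_ surj_q eq _]]] := tail_resolution res ae.
  have [|u uq] := exact_desc (f := g) eq surj_q; first exact: cg.
  have [v va] := extC _ _ _ _ ae u.
  by exists v => x; rewrite -aq va uq.
- move=> extC K P0 a b pP0 ab; apply/IHn => P p e res g cg.
  have := extC _ _ _ (cons_resolution pP0 ab res) g cg.
  by case: n {IHn extC} g cg.
- move=> extC P p e res g cg; have [pP surj_e pe pp] := res.
  have [K [a ae]] := epi_ses surj_e.
  have [q [aq resK]] := tail_resolution res ae.
  have /IHn extK := extC _ _ _ _ (pP 0%N) ae.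
  by have := extK _ _ _ resK g cg; case: n {IHn extC extK} g cg.
Qed.

End Resolutions.

(** * Injective cogenerators *)

Section Coinduced.
Variables (k : fieldType) (A : falgType k) (n : nat).

(** The module Hom_k(A, k^n), that is D(A)^n, on which [a] acts by
    f |-> f(a -). *)
Definition coind : Type := 'Hom(A, 'rV[k]_n).
HB.instance Definition _ := GRing.Zmodule.on coind.

Definition coind_eval (f : coind) : {linear A -> 'rV[k]_n} := (f : 'Hom(A, 'rV[k]_n)).
Definition coind_of (f : {linear A -> 'rV[k]_n}) : coind := linfun f.

Lemma coind_ofE f a : coind_eval (coind_of f) a = f a.
Proof. exact: lfunE. Qed.
Lemma coindP (f g : coind) : (forall a, coind_eval f a = coind_eval g a) -> f = g.
Proof. by move=> fg; apply/lfunP. Qed.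
Lemma coindD (f g : coind) a : coind_eval (f + g) a = coind_eval f a + coind_eval g a.
Proof. exact: add_lfunE. Qed.

Lemma coind_scale_linear (a : A) (f : coind) : linear (fun x : A => coind_eval f (a * x)).
Proof. by move=> c x y; rewrite mulrDr -scalerAr linearP. Qed.

Definition coind_scale (a : A^c) (f : coind) : coind :=
  coind_of (mklin (coind_scale_linear (a : A) f)).

Lemma coind_scaleE (a : A^c) (f : coind) x :
  coind_eval (coind_scale a f) x = coind_eval f ((a : A) * x).
Proof. exact: coind_ofE. Qed.

Fact coind_scaleA a b f : coind_scale a (coind_scale b f) = coind_scale (a * b) f.
Proof. by apply: coindP => x; rewrite !coind_scaleE mulrA. Qed.
Fact coind_scale1 : left_id 1 coind_scale.
Proof. by move=> f; apply: coindP => x; rewrite coind_scaleE mul1r. Qed.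
Fact coind_scaleDr : right_distributive coind_scale +%R.
Proof. by move=> a f g; apply: coindP => x; rewrite !(coindD, coind_scaleE). Qed.
Fact coind_scaleDl f : {morph coind_scale^~ f : a b / a + b}.
Proof.
move=> a b; apply: coindP => x; rewrite !(coindD, coind_scaleE).
by rewrite -linearD -mulrDl.
Qed.
HB.instance Definition _ := GRing.Zmodule_isLmodule.Build A^c coind
  coind_scaleA coind_scale1 coind_scaleDr coind_scaleDl.

Lemma coind_kscaleE c (f : kres coind) a :
  coind_eval (c *: f) a = c *: coind_eval f a.
Proof.
rewrite (_ : c *: f = coind_scale (c%:A : A) f) // coind_scaleE.
by rewrite -scalerAl mul1r linearZ.
Qed.

Lemma coind_fg : finitely_generated coind.
Proof.
pose r (u : 'rV[k]_(dim 'Hom(A, 'rV[k]_n))) : coind := (r2v u : 'Hom(A, 'rV[k]_n)).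
exists _, (fun i => r (delta_mx 0 i)) => f.
exists (fun i => (v2r (f : 'Hom(A, 'rV[k]_n)) 0 i)%:A : A).
rewrite -[f in LHS](v2rK (f : 'Hom(A, 'rV[k]_n))).
rewrite [X in r2v X]row_sum_delta linear_sum; apply: eq_bigr => i _.
apply: coindP => a; rewrite linearZ coind_scaleE.
rewrite -scalerAl mul1r linearZ; exact: scale_lfunE.
Qed.

Definition fgcoind : fgmod A := FgMod coind_fg.

(** The adjunction between coinduction and restriction to [k]. *)
Lemma coind_map_ex (X : fgmod A) (f : {linear kres X -> 'rV[k]_n}) :
  exists g : {linear X -> fgcoind},
    forall x (a : A), coind_eval (g x) a = f ((a : A^c) *: (x : X)).
Proof.
have lin_x (x : X) : linear (fun a : A => f ((a : A^c) *: x)).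
  by move=> c a b; rewrite scalerDl -kscale_scale linearP.
pose g x : fgcoind := coind_of (mklin (lin_x x)).
have gE x a : coind_eval (g x) a = f ((a : A^c) *: (x : X)) by exact: coind_ofE.
have lin_g : linear g.
  move=> a x y; apply: coindP => b; rewrite coindD coind_scaleE !gE.
  by rewrite scalerDr scalerA -linearD.
by exists (mklin lin_g).
Qed.

(** By the adjunction it suffices to extend a k-linear map. *)
Lemma coind_injective (K X : fgmod A) (a : {linear K -> X}) (u : {linear K -> fgcoind}) :
  injective a -> exists v : {linear X -> fgcoind}, forall x, v (a x) = u x.
Proof.
move=> inj_a; have [s sa] := ginverse_ex a (fgmod_fg K) (fgmod_fg X).
have lin_f : linear (fun x : kres X => coind_eval (u (s x)) 1).
  move=> c x y; pose F := lcomp (kmap u) s.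
  by rewrite -[u _]/(F _) linearP coindD coind_kscaleE.
have [v vE] := coind_map_ex (mklin lin_f); exists v => x.
apply: coindP => b; rewrite vE /= -linearZ.
have -> : s (a ((b : A^c) *: x)) = (b : A^c) *: x by apply: inj_a; rewrite sa.
by rewrite linearZ coind_scaleE mulr1.
Qed.

End Coinduced.

Section Cogenerators.
Variables (k : fieldType) (A : falgType k).

Lemma ext_zero_coind n i (X : fgmod A) : ext_zero i X (fgcoind A n).
Proof.
elim: i X => [|i IHi] X K Y a b; last by move=> _ _; exact: IHi.
by move=> [inj_a _ _] u; exact: coind_injective.
Qed.

(** The adjoint of a k-linear isomorphism X -> k^n is injective. *)
Lemma coind_embedding (X : fgmod A) :
  exists n (i : {linear X -> fgcoind A n}), injective i.
Proof.
have [n [r [r' rK r'K]]] := kdim_ex (fgmod_fg X).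
have lin_r' : linear r'.
  by move=> a x y; apply: (can_inj rK); rewrite linearP !r'K.
have [i iE] := coind_map_ex (mklin lin_r'); exists n, i => x y ixy.
apply: (can_inj r'K); rewrite -[x]scale1r -[y]scale1r.
by have := iE x 1; rewrite ixy iE.
Qed.

End Cogenerators.

(** * Minimal maps and coresolutions *)

Section Minimality.
Variables (k : fieldType) (A : falgType k).
Implicit Types I V W X Y Z K C N L E P Q D F G : fgmod A.
Implicit Types S : fgmod A -> Prop.

Lemma ker0_inj X Y (f : {linear X -> Y}) : (forall x, f x = 0 -> x = 0) -> injective f.
Proof. by move=> kerf; apply: raddf_inj; exact: kerf. Qed.

Lemma bij_linear_inv X Y (f : {linear X -> Y}) : bijective f ->
  exists g : {linear Y -> X}, cancel f g /\ cancel g f.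
Proof.
move=> [g fK gK]; have lin_g : linear g.
  by move=> a x y; apply: (can_inj fK); rewrite linearP !gK.
by exists (mklin lin_g).
Qed.

Lemma image_ex X Y (f : {linear X -> Y}) :
  exists I (t : {linear X -> I}) (i : {linear I -> Y}),
    [/\ surj t, injective i & forall x, i (t x) = f x].
Proof.
have [I [i [inj_i im_i]]] := fgsub_ex (image_submodule f).
have [|t it] := factor_inj (f := f) inj_i; first by move=> x; apply/im_i; exists x.
exists I, t, i; split=> // z; have /im_i [x fx] : exists z', i z' = i z by exists z.
by exists x; apply: inj_i; rewrite it.
Qed.

(** Among the images of endomorphisms of [Y] that fix [y], one of smallest
    dimension is a direct summand on which [y] is left minimal. *)
Lemma left_minimal_part C Y (y : {linear C -> Y}) :
  exists Y' (rho : {linear Y -> Y'}) (iota : {linear Y' -> Y}),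
    [/\ forall x, rho (iota x) = x, forall c, iota (rho (y c)) = y c
      & forall eta : {linear Y' -> Y'},
          (forall c, eta (rho (y c)) = rho (y c)) -> bijective eta].
Proof.
pose Q m := `[< exists I (t : {linear Y -> I}) (i : {linear I -> Y}),
  [/\ surj t, injective i, forall c, i (t (y c)) = y c & kdim I m] >].
have exQ : exists m, Q m.
  have [m dimY] := kdim_ex (fgmod_fg Y); exists m; apply/asboolP.
  by exists Y, (lid Y), (lid Y); split=> // z; exists z.
case: (ex_minnP exQ) => m /asboolP [I [t [i [surj_t inj_i ity dimI]]]] min_m.
have minI (eta : {linear I -> I}) :
    (forall c, i (eta (t (y c))) = y c) -> bijective eta.
  move=> eta_y; apply: inj_endo_bij; first exact: fgmod_fg.
  apply: contrapT => ninj.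
  have [I' [t' [i' [surj_t' inj_i' i't']]]] := image_ex eta.
  have [m' dimI'] := kdim_ex (fgmod_fg I').
  have: (m <= m')%N.
    apply: min_m; apply/asboolP; exists I', (lcomp t' t), (lcomp i i').
    split=> //; first exact: surj_comp.
      by move=> u v /inj_i /inj_i'.
    by move=> c; rewrite /= i't'.
  rewrite leqNgt => /negP; apply.
  apply: kdim_surj dimI dimI' surj_t' _ => inj_t'; apply: ninj => u v.
  by rewrite -!i't' => /inj_i' /inj_t'.
(* By minimality [t] restricts to an automorphism of [I], so that [I] is a
   direct summand of [Y]. *)
have [|J [JK KJ]] := @bij_linear_inv _ _ (lcomp t i).
  by apply: minI => c; rewrite /= !ity.
have Jy c : J (t (y c)) = t (y c).
  by rewrite -[RHS]JK /= ity.
exists I, (lcomp J t), i; split=> [x|c|eta eta_y].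
- exact: JK.
- by rewrite /= Jy ity.
- by apply: minI => c; have /= := eta_y c; rewrite Jy => ->; rewrite ity.
Qed.

Lemma subcategory_retract S X Z (s : {linear X -> Z}) (t : {linear Z -> X}) :
  subcategory S -> (forall x, t (s x) = x) -> S Z -> S X.
Proof.
move=> subS ts; have [W [i [inj_i it]]] := ker_ex t.
have [|w iw] := exact_lift (f := lsub (lid Z) (lcomp s t)) inj_i it.
  by move=> z /=; rewrite linearB ts subrr.
apply: (subcategory_summand subS (Y := W)).
exists (lpair t w); exists (fun p => s p.1 + i p.2) => [z|[x v]] /=.
  by rewrite iw /= addrC subrK.
have ti := exact0 v it.
apply: fgprod_ext => /=; first by rewrite linearD ts ti addr0.
by apply: inj_i; rewrite iw /= linearD ts ti addr0 addrAC subrr add0r.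
Qed.

Lemma subcategory_prod S X Y : subcategory S -> S X -> S Y -> S (fgprod X Y).
Proof.
move=> subS; apply: (subcategory_sum subS); exists (lid (X * Y)%type).
by exists id.
Qed.

End Minimality.

Section ClusterTilting.
Variables (k : fieldType) (A : falgType k) (d : nat) (M : fgmod A -> Prop).
Hypothesis clM : cluster_tilting d M.
Implicit Types I V W X Y Z K C N L E P Q D F G : fgmod A.
Implicit Types S : fgmod A -> Prop.

Lemma ct_subcategory : subcategory M.
Proof. by case: clM. Qed.

Lemma ct_extP X : M X <-> forall N n, M N -> (n < d - 1)%N -> ext_zero n X N.
Proof.
have [_ _ extl _] := clM; rewrite extl; split=> extX N.
  by move=> n MN ltn; apply/Ext_vanishesP; apply: extX.
by move=> MN [|n] // ltn; apply/Ext_vanishesP; exact: extX.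
Qed.

Lemma ct_ext X N n : M X -> M N -> (n < d - 1)%N -> ext_zero n X N.
Proof. by move=> /ct_extP extX; exact: extX. Qed.

Lemma ct_projective P : projective P -> M P.
Proof. by move=> pP; apply/ct_extP => N n _ _; exact: ext_zero_projective. Qed.

Lemma ct_zero Z : (forall z : Z, z = 0) -> M Z.
Proof. by move=> Z0; apply: ct_projective; exact: projective_zero. Qed.

Lemma ct_coind n : M (fgcoind A n).
Proof.
have [_ _ _ extr] := clM; apply/extr => N MN [|i] // _.
by apply/Ext_vanishesP; exact: ext_zero_coind.
Qed.

(** An approximation is injective because an embedding into an injective module,
    which lies in [M], factors through it. *)
Lemma ct_left_approx F : exists Y (y : {linear F -> Y}),
  [/\ M Y, injective y & forall N (g : {linear F -> N}), M N ->
     exists g' : {linear Y -> N}, forall x, g' (y x) = g x].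
Proof.
have [_ ffM _ _] := clM; have [_ [Y [y [MY approx]]]] := ffM F.
have [n [i inj_i]] := coind_embedding F.
have [i' i'y] := approx _ i (ct_coind n).
exists Y, y; split=> // u v; by move=> /(congr1 i'); rewrite !i'y => /inj_i.
Qed.

(** The existence of an exact sequence 0 -> C -> Y_1 -> ... -> Y_n -> Z -> 0
    with the Y_i in [M] and Z in [S], spliced from short exact sequences. If
    [rad] holds, the epimorphisms onto the successive cokernels are radical. *)
Fixpoint coresolved (rad : bool) S (n : nat) (C : fgmod A) : Prop :=
  match n with
  | 0 => S C
  | m.+1 => exists Y D (a : {linear C -> Y}) (b : {linear Y -> D}),
              [/\ M Y, ses a b, rad -> radical b & coresolved rad S m D]
  end.

(** The module [C] is an n-th syzygy of an object of [S]. *)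
Fixpoint syzygy_of S (n : nat) (C : fgmod A) : Prop :=
  match n with
  | 0 => S C
  | m.+1 => exists P D (a : {linear C -> P}) (b : {linear P -> D}),
              [/\ projective P, ses a b & syzygy_of S m D]
  end.

Lemma syzygy_of_zero S n Z : (forall z : Z, z = 0) -> S Z -> syzygy_of S n Z.
Proof.
move=> Z0 SZ; elim: n => [//|n IHn]; exists Z, Z, (lid Z), (lid Z); split=> //.
  exact: projective_zero.
by split=> // [z|z]; [rewrite (Z0 z); split=> // _; exists 0 | exists z].
Qed.

Lemma coresolved_ext rad S n i C N : (forall X, S X -> M X) ->
  coresolved rad S n C -> M N ->
  (i + n < d - 1)%N -> ext_zero i C N.
Proof.
move=> SM; elim: n i C => [|n IHn] i C /=.
  by move=> /SM MC MN; rewrite addn0; exact: ct_ext.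
move=> [Y [D [a [b [MY ab _ chD]]]]] MN; rewrite addnS -addSn => ltid.
apply: (proj2 (ext_les i N ab)); last exact: IHn.
by apply: ct_ext => //; apply: leq_trans ltid; rewrite ltnS addSn ltnW // ltnS leq_addr.
Qed.

(** Lifting a map [h] from [Z] along [f n] by dimension shifting. A lift exists
    on a projective module mapping onto [Z]; on the syzygy it takes its values
    in the kernel of [f n], and if it lifts further there, the vanishing of Ext
    allows to correct it so that it descends to [Z]. This leads to a lifting problem
    along [f 0] for the n-th syzygy, which is the last hypothesis. *)
Lemma lift_exact S n : forall m Z (X : nat -> fgmod A)
    (f : forall i, {linear X i -> X i.+1}) (h : {linear Z -> X n.+1}),
  syzygy_of S m Z ->
  (forall i, (i < n)%N -> exact (f i) (f i.+1)) ->
  (forall z, exists x, f n x = h z) ->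
  (forall i j, (i + j).+1 = n -> ext_zero i Z (X j)) ->
  (forall K, syzygy_of S (m + n) K -> forall h0 : {linear K -> X 1%N},
     (forall z, exists x, f 0%N x = h0 z) ->
     exists h1 : {linear K -> X 0%N}, forall z, f 0%N (h1 z) = h0 z) ->
  exists h' : {linear Z -> X n}, forall z, f n (h' z) = h z.
Proof.
elim: n => [|n IHn] m Z X f h pZ ex_f im_h extZ base.
  by apply: base => //; rewrite addn0.
have [K [P [a [b [pP ab]]]]] := presentation_ex Z; have [inj_a eab surj_b] := ab.
have [I [t [i [surj_t inj_i it]]]] := image_ex (f n.+1).
have [h0 ih0] : exists h0 : {linear Z -> I}, forall z, i (h0 z) = h z.
  apply: factor_inj inj_i _ => z; have [x fx] := im_h z.
  by exists (t x); rewrite it.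
have [phi tphi] := pP _ _ t (lcomp h0 b) surj_t.
have fphi x : f n.+1 (phi x) = h (b x) by rewrite -it tphi ih0.
have [|||||psi fpsi] := IHn m.+1 K X f (lcomp phi a).
- by exists P, Z, a, b.
- by move=> j ltjn; apply: ex_f; exact: ltnW.
- move=> z; apply/(ex_f n (ltnSn n)); rewrite /= fphi (exact0 _ eab); exact: linear0.
- by move=> j l jl; apply: (extZ j.+1 l _ _ _ _ _ pP ab); rewrite addSn jl.
- by move=> L; rewrite addSnnS; exact: base.
have [s sa] : exists s : {linear P -> X n}, forall x, s (a x) = psi x.
  exact: (extZ 0%N n (erefl _)) ab psi.
have [|h' h'b] := exact_desc (f := lsub phi (lcomp (f n) s)) eab surj_b.
  by move=> x; rewrite /= sa fpsi subrr.
exists h' => z; have [x <-] := surj_b z; rewrite h'b /= linearB fphi.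
by rewrite (exact0 _ (ex_f n (ltnSn n))) subr0.
Qed.

(** Gluing left approximations of [F] to the projectives between [K] and the
    object Z of [S] of which it is an n-th syzygy: the result is an exact
    sequence C -> Y_1 -> ... -> Y_{n+1} -> Z -> 0 whose first map factors through
    an approximation of [F]. From one step to the next there is one more degree
    in which Ext(F, M) vanishes, so that in the end [F] itself lies in [M]. For
    K = 0 this is the coresolution of [F] by approximations. *)
Lemma approx_coresolved S n : (forall X, S X -> M X) ->
  forall C F K (i : {linear C -> F}) (q : {linear F -> K}),
  ses i q -> syzygy_of S n K -> (n < d)%N ->
  (forall N j, M N -> (j + n < d - 1)%N -> ext_zero j F N) ->
  exists Y D (y : {linear F -> Y}) (b : {linear Y -> D}),
    [/\ M Y, ses (lcomp y i) b, coresolved false S n D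
      & forall N (g : {linear F -> N}), M N ->
          exists g' : {linear Y -> N}, forall x, g' (y x) = g x].
Proof.
move=> SM; elim: n => [|n IHn] C F K i q iq.
  move=> SK _ extF; exists F, K, (lid F), q; split=> //.
    by apply/ct_extP => N j MN ltj; apply: extF; rewrite ?addn0.
  by move=> N g _; exists g.
move=> [P [K' [p [p' [pP pp' chK']]]]] ltnd extF.
have [inj_i eiq surj_q] := iq; have [inj_p epp' surj_p'] := pp'.
have [Y [y [MY inj_y approx]]] := ct_left_approx F.
have [|D [b yib]] := @mono_ses _ _ _ _ (lcomp y i); first by move=> u v /inj_y /inj_i.
have [_ eyib surj_b] := yib.
have [|kap kapq] := exact_desc (f := lcomp b y) eiq surj_q.
  by move=> x; exact: (exact0 x eyib).
have inj_kap : injective kap.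
  apply: ker0_inj => z; have [x <-] := surj_q z; rewrite kapq => /eyib [c yic].
  by rewrite -(inj_y _ _ yic) (exact0 _ eiq).
(* The pushout of [D] and [P] over [K] takes the place of [F]. *)
have [F' [r [er surj_r]]] := coker_ex (lpair kap (lopp p) : {linear K -> fgprod D P}).
have [i' i'E] : exists i' : {linear D -> F'}, forall c, i' c = r (c, 0).
  by exists (lcomp r (lpair (lid D) (lzero D P) : {linear D -> fgprod D P})).
have [jP jPE] : exists jP : {linear P -> F'}, forall x, jP x = r (0, x).
  by exists (lcomp r (lpair (lzero P D) (lid P) : {linear P -> fgprod D P})).
have rE c x : r (c, x) = i' c + jP x.
  rewrite i'E jPE -linearD; congr (r _).
  by apply: fgprod_ext; rewrite /= ?addr0 ?add0r.
have glue w : i' (kap w) = jP (p w).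
  apply/subr0_eq; rewrite -linearN -rE; apply/er.
  by exists w.
have [|q' q'r] := exact_desc
  (f := lcomp p' (lsnd D P) : {linear fgprod D P -> K'}) er surj_r.
  by move=> w; rewrite /= linearN (exact0 _ epp') oppr0.
have iq' : ses i' q'.
  split.
  - apply: ker0_inj => c; rewrite i'E => /er [w [kw pw]].
    have w0 : w = 0 by apply: inj_p; rewrite linear0 -[p w]opprK [X in - X]pw oppr0.
    by rewrite -kw w0 linear0.
  - move=> v; have [[c x] <-] := surj_r v; rewrite q'r /=; split=> [/epp' [w <-]|[u]].
      by exists (c + kap w); rewrite linearD glue -rE.
    move=> /(congr1 q'); rewrite i'E !q'r /= => <-; exact: linear0.
  - move=> z; have [x <-] := surj_p' z; exists (jP x); rewrite jPE q'r //.
(* The pushout is also an extension by [P] of the cokernel [G] of the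
   approximation, which governs its Ext groups. *)
have [G [g yg]] := mono_ses inj_y; have [_ eyg surj_g] := yg.
have [|g1 g1b] := exact_desc (f := g) eyib surj_b.
  by move=> x; exact: (exact0 _ eyg).
have [|g' g'r] := exact_desc
  (f := lcomp g1 (lfst D P) : {linear fgprod D P -> G}) er surj_r.
  by move=> w; have [x <-] := surj_q w; rewrite /= kapq /= g1b (exact0 _ eyg).
have jg : ses jP g'.
  split.
  - apply: ker0_inj => x; rewrite jPE => /er [w [kw pw]].
    have w0 : w = 0 by apply: inj_kap; rewrite linear0.
    by rewrite -pw w0 linear0 oppr0.
  - move=> v; have [[c x] <-] := surj_r v; rewrite g'r /=; split=> [gc|[u]].
      have [z bz] := surj_b c; move: gc; rewrite -bz g1b => /eyg [f yf].
      exists (p (q f) + x); rewrite linearD -glue -rE kapq /= yf //.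
    move=> /(congr1 g'); rewrite jPE !g'r /= => <-; exact: linear0.
  - move=> z; have [x <-] := surj_g z; exists (i' (b x)); rewrite i'E g'r /= g1b //.
have [||Y' [D' [y' [b' [MY' yib' chD' _]]]]] := IHn _ _ _ i' q' iq' chK'.
- exact: ltnW.
- move=> N j MN ltj; apply: (proj1 (ext_les j N jg)); first exact: ext_zero_projective.
  have ltjd : (j < d - 1)%N by apply: leq_ltn_trans ltj; exact: leq_addr.
  case: j => [|j] in ltj ltjd *.
    apply: (ext_les_coker0 yg); last exact: ct_ext.
    by move=> u; exact: approx.
  apply: (ext_les_coker yg); last exact: ct_ext.
  by apply: extF; rewrite // addnS -addSn.
exists Y, D, y, b; split=> //.
by exists Y', D', (lcomp y' i'), b'; split.
Qed.

(** The projection from [D] to the summand [W] in [M] extends to the next term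
    of the coresolution, as Ext^1 of the cokernel with [W] vanishes; its kernel
    is the next term of a coresolution of the complement of [W]. *)
Lemma coresolved_summand S n : subcategory S -> (forall X, S X -> M X) -> (n < d)%N ->
  forall D D' W (c : {linear D' -> D}) (t : {linear D -> D'}) (w : {linear D -> W})
    (s : {linear W -> D}),
  M W -> ses c w -> (forall x, t (c x) = x) -> (forall x, w (s x) = x) ->
  coresolved false S n D -> coresolved false S n D'.
Proof.
move=> subS SM; case: n => [|n] ltnd D D' W c t w s MW [inj_c ecw surj_w] tc ws /=.
  by move=> SD; exact: subcategory_retract subS tc SD.
move=> [Y [E [a [b [MY ab _ chE]]]]]; have [inj_a eab surj_b] := ab.
have extE : ext_zero 0 E W.
  by apply: coresolved_ext SM chE MW _; rewrite add0n ltn_subRL add1n.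
have [r ra] := extE _ _ _ _ ab w.
have [Y' [j [inj_j ejr]]] := ker_ex r.
have [|a' ja'] := exact_lift (f := lcomp a c) inj_j ejr.
  by move=> x; rewrite /= ra (exact0 _ ecw).
have [|u ju] := exact_lift (f := lsub (lid Y) (lcomp a (lcomp s r))) inj_j ejr.
  by move=> x; rewrite /= linearB ra ws subrr.
exists Y', E, a', (lcomp b j); split=> //.
- apply: (subcategory_retract (s := j) (t := u) ct_subcategory _ MY) => x.
  by apply: inj_j; rewrite ju /= (exact0 _ ejr) !linear0 addr0.
- split.
  + by move=> x y axy; apply/inj_c/inj_a; have := congr1 j axy; rewrite !ja'.
  + move=> v; split=> [/eab [x ax]|[x <-]]; last first.
      by rewrite /= ja' /= (exact0 _ eab).
    have /ecw [z cz] : w x = 0 by rewrite -ra ax (exact0 _ ejr).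
    by exists z; apply: inj_j; rewrite ja' /= cz.
  + move=> z; have [v <-] := surj_b z; exists (u v).
    by rewrite /= ju /= linearB (exact0 _ eab) subr0.
Qed.

(** Splitting off a complement [W] of the left minimal part of [y]. It is also
    a summand of the cokernel [D]. For a left minimal map [y'] the cokernel map
    [b'] is radical: the endomorphisms 1 - g b' fix [y']. *)
Lemma coresolved_minimal_step S n : subcategory S ->
  (forall X, S X -> M X) -> (n < d)%N ->
  forall C Y D (y : {linear C -> Y}) (b : {linear Y -> D}),
  M Y -> ses y b -> coresolved false S n D ->
  exists Y' D' (y' : {linear C -> Y'}) (b' : {linear Y' -> D'})
    (rho : {linear Y -> Y'}) (iota : {linear Y' -> Y}),
    [/\ M Y', ses y' b', radical b', coresolved false S n D'
      & forall c, rho (y c) = y' c /\ iota (y' c) = y c].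
Proof.
move=> subS SM ltnd C Y D y b MY [inj_y eyb surj_b] chD.
have [Y' [rho [iota [rhoK iotay minY']]]] := left_minimal_part y.
have [|D' [b' yb']] := @mono_ses _ _ _ _ (lcomp rho y).
  by move=> u v /(congr1 iota); rewrite /= !iotay => /inj_y.
have [inj_y' eyb' surj_b'] := yb'.
exists Y', D', (lcomp rho y), b', rho, iota; split=> //;
  last by move=> c; split; rewrite /= ?iotay.
- exact: (subcategory_retract ct_subcategory rhoK MY).
- move=> g; apply: (minY' (lsub (lid Y') (lcomp g b'))) => c /=.
  by rewrite (exact0 c eyb') linear0 subr0.
have [W [j [inj_j ejr]]] := ker_ex rho.
have [|p jp] := exact_lift (f := lsub (lid Y) (lcomp iota rho)) inj_j ejr.
  by move=> v; rewrite /= linearB rhoK subrr.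
have pj v : p (j v) = v by apply: inj_j; rewrite jp /= (exact0 _ ejr) linear0 subr0.
have [|c cb'] := exact_desc (f := lcomp b iota) eyb' surj_b'.
  by move=> x; rewrite /= iotay (exact0 _ eyb).
have [|t tb] := exact_desc (f := lcomp b' rho) eyb surj_b.
  by move=> x; exact: (exact0 x eyb').
have [|w wb] := exact_desc (f := p) eyb surj_b.
  by move=> x; apply: inj_j; rewrite jp /= iotay subrr linear0.
have tc x : t (c x) = x by have [v <-] := surj_b' x; rewrite cb' /= tb /= rhoK.
have ws x : w (lcomp b j x) = x by rewrite /= wb pj.
have cw : ses c w.
  split; first exact: can_inj tc; last by move=> x; exists (b (j x)); exact: ws.
  move=> z; split=> [|[x <-]].
    have [v <-] := surj_b z; rewrite wb => pv0; exists (b' (rho v)).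
    rewrite cb' /=; congr (b _); apply/esym/subr0_eq.
    by have := jp v; rewrite pv0 linear0.
  have [v <-] := surj_b' x; rewrite cb' /= wb; apply: inj_j.
  by rewrite jp /= rhoK subrr linear0.
apply: (coresolved_summand subS SM ltnd _ cw tc ws chD).
exact: (subcategory_retract ct_subcategory pj MY).
Qed.

(** Radical coresolutions, obtained by repeating the preceding step. The first
    map of the given sequence and its left minimal part factor through each
    other. *)
Lemma coresolved_minimal S n : subcategory S -> (forall X, S X -> M X) -> (n < d)%N ->
  forall C Y D (y : {linear C -> Y}) (b : {linear Y -> D}),
  M Y -> ses y b -> coresolved false S n D ->
  exists Y' D' (y' : {linear C -> Y'}) (b' : {linear Y' -> D'})
    (rho : {linear Y -> Y'}) (iota : {linear Y' -> Y}),
    [/\ M Y', ses y' b', radical b', coresolved true S n D'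
      & forall c, rho (y c) = y' c /\ iota (y' c) = y c].
Proof.
move=> subS SM; elim: n => [|n IHn] ltnd C Y D y b MY yb chD.
  exact: (coresolved_minimal_step subS SM ltnd MY yb chD).
have [Y' [D' [y' [b' [rho [iota [MY' yb' rad' chD' yy']]]]]]] :=
  coresolved_minimal_step subS SM ltnd MY yb chD.
exists Y', D', y', b', rho, iota; split=> //.
have [Y2 [D2 [y2 [b2 [MY2 yb2 _ chD2]]]]] := chD'.
have [Y3 [D3 [y3 [b3 [_ [_ [MY3 yb3 rad3 chD3 _]]]]]]] :=
  IHn (ltnW ltnd) _ _ _ _ _ MY2 yb2 chD2.
by exists Y3, D3, y3, b3; split.
Qed.

Definition cons_map X0 (X : nat -> fgmod A) (g : {linear X0 -> X 0%N})
    (f : forall i, {linear X i -> X i.+1}) (i : nat) :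
    {linear cons_obj X0 X i -> cons_obj X0 X i.+1} :=
  match i with 0 => g | j.+1 => f j end.

(** The composites Y_i -> Y_{i+1} form a family indexed by all natural numbers,
    constrained in finitely many places. An epimorphism from a further module
    [X0] onto [C] can be put in front of it. *)
Lemma coresolved_family rad S n C : coresolved rad S n C ->
  exists (Y : nat -> fgmod A) (f : forall i, {linear Y i -> Y i.+1})
    (e : {linear C -> Y 0%N}),
    [/\ forall X0 (q : {linear X0 -> C}), surj q ->
          (forall i, (i < n)%N -> exact (cons_map (lcomp e q) f i) (f i)) /\
          surj (cons_map (lcomp e q) f n),
        injective e,
        forall i, (i < n)%N -> M (Y i),
        S (Y n)
      & forall i, (i < n)%N -> rad -> radical (f i)].
Proof.
elim: n C => [|n IHn] C /=.
  by move=> SC; exists (fun=> C), (fun=> lid C), (lid C); split.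
move=> [Y1 [D [a [b [MY1 [inj_a eab surj_b] radb /IHn]]]]].
move=> [Y [f [e [exY inj_e MY SY radf]]]].
exists (cons_obj Y1 Y), (cons_map (lcomp e b) f), a; split=> //.
- move=> X0 q surj_q; have [ex_f surj_f] := exY _ _ surj_b; split=> //.
  by case=> [|i] ltin; [exact/exact_mono/exact_epi | exact: ex_f].
- by case=> [|i] // ltin; exact: MY.
- case=> [|i] ltin rdb; last exact: radf.
  by move=> g; exact: (radb rdb (lcomp g e)).
Qed.

End ClusterTilting.

(** * Higher torsion classes *)

Section Sequences.
Variables (k : fieldType) (A : falgType k) (d : nat) (M : fgmod A -> Prop).
Hypothesis clM : cluster_tilting d M.
Implicit Types I V W X Y Z K C N L E P Q D F G T : fgmod A.

Lemma coker_ses (X : nat -> fgmod A) (f : forall i, {linear X i -> X i.+1}) j C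
    (c : {linear X j.+1 -> C}) :
  exact (f j) (f j.+1) -> exact (f j) c -> surj c ->
  exists C' (c' : {linear X j.+2 -> C'}) (m : {linear C -> X j.+2}),
    [/\ ses m c', exact (f j.+1) c', surj c' & forall x, m (c x) = f j.+1 x].
Proof.
move=> ff fc surj_c; have [C' [c' [fc' surj_c']]] := coker_ex (f j.+1).
have [|m mc] := exact_desc (f := f j.+1) fc surj_c; first by move=> x; exact: exact0 ff.
exists C', c', m; split=> //; split=> //.
- apply: ker0_inj => z; have [x <-] := surj_c z; rewrite mc => /ff [y <-].
  exact: exact0 fc.
- move=> y; rewrite fc'; split=> [[x <-]|[z <-]]; first by exists (c x).
  by have [x <-] := surj_c z; exists x.
Qed.

(** Dimension shifting along C -> X_{j+2} -> ... -> X_{d+1} -> 0, where [C] is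
    the cokernel of [f j]. *)
Lemma coker_ext (X : nat -> fgmod A) (f : forall i, {linear X i -> X i.+1}) L :
  right_exact_seq d M f -> M L -> forall s j, (j + s)%N = d ->
  forall C (c : {linear X j.+1 -> C}), exact (f j) c -> surj c ->
  forall i, (i < j)%N -> ext_zero i C L.
Proof.
move=> [MX ex_f surj_f] ML; elim=> [|s IHs] j js C c fc surj_c i ltij.
  apply: ext_zero_projective; apply: projective_zero => z.
  have [x <-] := surj_c z; rewrite addn0 in js; subst j.
  by have [y <-] := surj_f x; exact: exact0 fc.
have ltjd : (j < d)%N by rewrite -js -addSnnS leq_addr.
have [C' [c' [m [mc' fc' surj_c' _]]]] := coker_ses (ex_f j ltjd) fc surj_c.
apply: (proj2 (ext_les i L mc')); last first.
  by apply: (IHs _ _ _ _ fc' surj_c'); rewrite ?ltnS // addSnnS.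
by apply: (ct_ext clM) => //; [exact: MX | lia].
Qed.

(** The obstruction lies in Ext^1 of the cokernel of the next map. *)
Lemma right_exact_extend (X : nat -> fgmod A) (f : forall i, {linear X i -> X i.+1})
    L j (phi : {linear X j.+1 -> L}) :
  right_exact_seq d M f -> M L -> (j < d)%N -> (forall x, phi (f j x) = 0) ->
  exists psi : {linear X j.+2 -> L}, forall x, psi (f j.+1 x) = phi x.
Proof.
move=> resX ML ltjd phi0; have [MX ex_f surj_f] := resX.
have [C [c [fc surj_c]]] := coker_ex (f j).
have [C' [c' [m [mc' fc' surj_c' mc]]]] := coker_ses (ex_f j ltjd) fc surj_c.
have [phi' phi'c] := exact_desc fc surj_c phi0.
have ext0 : ext_zero 0 C' L.
  by apply: (@coker_ext X f L resX ML (d - j.+1)%N j.+1 _ _ c'); rewrite ?subnKC.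
have [psi psim] := ext0 _ _ _ _ mc' phi'.
by exists psi => x; rewrite -mc psim phi'c.
Qed.

Lemma lift_inner (X : nat -> fgmod A) (f : forall i, {linear X i -> X i.+1}) Y n
    (h : {linear Y -> X n.+1}) :
  right_exact_seq d M f -> injective (f 0%N) -> M Y -> (n < d)%N ->
  (forall y, f n.+1 (h y) = 0) ->
  exists h' : {linear Y -> X n}, forall y, f n (h' y) = h y.
Proof.
move=> [MX ex_f surj_f] inj_f MY ltnd fh.
apply: (@lift_exact _ _ (fun=> True) n 0 Y X f h) => //.
- by move=> i ltin; apply: ex_f; lia.
- by move=> z; apply/(ex_f n ltnd).
- by move=> i j ijn; apply: (ct_ext clM) => //; [apply: MX | ]; lia.
- by move=> K _ h0 im_h0; exact: factor_inj.
Qed.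

End Sequences.

Section TorsionClasses.
Variables (k : fieldType) (A : falgType k) (d : nat) (M U : fgmod A -> Prop).
Hypotheses (clM : cluster_tilting d.+1 M) (subU : subcategory U).
Hypothesis UM : forall X, U X -> M X.
Implicit Types I V W X Y Z K C N L E P Q D F G T : fgmod A.

(** The torsion sequence of [N] as a family whose second term is convertible to
    [N]. *)
Lemma torsion_seq N : torsion_class d.+1 M U -> M N ->
  exists T (i : {linear T -> N}) (V : nat -> fgmod A) (v0 : {linear N -> V 0%N})
    (v : forall j, {linear V j -> V j.+1}),
    let w := cons_map i (cons_map v0 v) in
    [/\ U T, right_exact_seq d.+1 M w, injective i
      & forall Y, U Y -> hom_exact_seq d.+1 w Y].
Proof.
move=> torU /torU [X [f [eqN UX0 [MX ex_f surj_f] inj_f homX]]]; subst N.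
exists (X 0%N), (f 0%N), (fun j => X j.+2), (f 1%N), (fun j => f j.+2) => w.
split=> //.
- split=> //; first by case=> [|[|i]] lti; apply: (MX _ lti).
  by case=> [|[|i]] lti; apply: (ex_f _ lti).
  by case: d surj_f {ex_f MX homX} => [|[|d']].
- by move=> Y /homX homY [|j] ltj h; exact: (homY _ ltj h).
Qed.

(** Induction along the tail of the sequence [X] that starts at X_{j+1}: the map
    [h] is pushed to the right by [right_exact_extend] until it reaches the
    object of [U] at the end, where it lifts by the torsion property; the lift
    at the next position corrects [h], without changing it on the image of
    [f j], so that it lifts by [lift_inner]. *)
Lemma torsion_chase (W X : nat -> fgmod A)
    (w : forall i, {linear W i -> W i.+1}) (f : forall i, {linear X i -> X i.+1}) :
  right_exact_seq d.+1 M w -> injective (w 0%N) ->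
  (forall Y, U Y -> hom_exact_seq d.+1 w Y) ->
  right_exact_seq d.+1 M f -> U (X d.+2) ->
  forall s j n (h : {linear X j.+1 -> W n.+2}), (n + s <= d)%N -> (j + s)%N = d.+1 ->
  ((n < d)%N -> forall x, w n.+2 (h (f j x)) = 0) ->
  exists sigma : {linear X j.+1 -> W n.+1},
    forall x, w n.+1 (sigma (f j x)) = h (f j x).
Proof.
move=> resW inj_w homW resX UZ; have [MW ex_w surj_w] := resW.
have [MX ex_f surj_f] := resX.
elim=> [|s IHs] j n h le_ns js wh.
  rewrite addn0 in js; rewrite addn0 in le_ns; subst j.
  have := (homW _ UZ n le_ns h).1; case: eqP => [n0|n0] lift_h.
    exists (lzero _ _) => x; rewrite /= linear0 lift_h // => ltn u.
    by have [x' <-] := surj_f u; exact: wh.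
  have [|h' h'E] := lift_h; last by exists h' => x; exact: h'E.
  by move=> ltn u; have [x' <-] := surj_f u; exact: wh.
have ltnd : (n < d)%N by lia.
have [|||h1 h1f] := right_exact_extend clM (phi := lcomp (w n.+2) h) resX.
- by apply: MW; lia.
- by lia.
- exact: wh.
have [|||sigma1 sigma1E] := IHs j.+1 n.+1 h1.
- by lia.
- by lia.
- by move=> ltn x; rewrite h1f /=; apply: exact0 (ex_w _ _); lia.
have [|||sigma sigmaE] :=
  lift_inner clM (h := lsub h (lcomp sigma1 (f j.+1))) resW inj_w.
- by apply: MX; lia.
- by lia.
- by move=> x; rewrite /= linearB sigma1E h1f subrr.
exists sigma => x; rewrite sigmaE /=.
have -> : f j.+1 (f j x) = 0 by apply: exact0 (ex_f _ _); lia.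
by rewrite linear0 subr0.
Qed.

Lemma torsion_class_closed : torsion_class d.+1 M U ->
  forall (X : nat -> fgmod A) (f : forall i, {linear X i -> X i.+1}),
  right_exact_seq d.+1 M f ->
  (forall i, (1 <= i <= d)%N -> radical (f i)) ->
  U (X 0%N) -> U (X d.+2) -> forall i, (i <= d.+1)%N -> U (X i).
Proof.
move=> torU X f resX rad_f UX0 UZ; elim=> [//|m IHm] ltmd.
have UXm := IHm (ltnW ltmd); have [MX ex_f surj_f] := resX.
have [T [i [V [v0 [v]]]]] := torsion_seq torU (MX m.+1 (leqW ltmd)).
set w := cons_map i (cons_map v0 v) => -[UT resW inj_i homW].
have [MW ex_w surj_w] := resW.
have hom0 Y (h : {linear Y -> V 0%N}) : U Y ->
    ((1 < d.+1)%N -> forall u, v 0%N (h u) = 0) -> forall u, h u = 0.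
  by move=> UY; exact: (homW Y UY 0%N isT h).1.
have vv0 : (1 < d.+1)%N -> forall x, v 0%N (v0 x) = 0.
  by move=> lt1 x; exact: exact0 (ex_w 1%N lt1).
have iv0 : exact i v0 by exact: (ex_w 0%N isT).
have retr (g : {linear X m.+1 -> X m.+1}) : bijective g ->
    (forall x, v0 (g x) = 0) -> U (X m.+1).
  move=> /bij_linear_inv [g' [gK g'K]] v0g.
  have [tau itau] := exact_lift inj_i iv0 v0g.
  by apply: (subcategory_retract (s := tau) (t := lcomp g' i) subU _ UT) => x;
    rewrite /= itau gK.
have [||h1 h1f] := right_exact_extend clM (phi := v0) resX _ ltmd.
- exact: (MW 2%N).
- by apply: (hom0 _ (lcomp v0 (f m))) => // lt1 u; exact: vv0.
have vh1 : (1 < d.+1)%N -> forall x, v 0%N (h1 (f m.+1 x)) = 0.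
  by move=> lt1 x; rewrite h1f; exact: vv0.
move: ltmd; rewrite ltnS leq_eqVlt => /orP [/eqP md|ltmd].
  apply: (retr (lid _)) => [|x]; first by exists id.
  rewrite /= -h1f; subst m; apply: (hom0 _ h1) => // lt1 u.
  by have [x' <-] := surj_f u; exact: vh1.
have [|||sigma sigmaE] := torsion_chase resW inj_i homW resX UZ
  (s := d - m) (j := m.+1) (n := 0%N) (h := h1).
- by rewrite leq_subr.
- by rewrite addSn subnKC // ltnW.
- exact: vh1.
apply: (retr (lsub (lid _) (lcomp sigma (f m.+1)))).
  exact: (rad_f m.+1 ltmd).
by move=> x; rewrite /= linearB -[v0 (sigma _)]/(w 1%N _) sigmaE h1f subrr.
Qed.

Hypothesis closedU :
  forall (X : nat -> fgmod A) (f : forall i, {linear X i -> X i.+1}),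
  right_exact_seq d.+1 M f ->
  (forall i, (1 <= i <= d)%N -> radical (f i)) ->
  U (X 0%N) -> U (X d.+2) -> forall i, (1 <= i <= d.+1)%N -> U (X i).

(** Composing [q] with the radical version of the given sequence yields a right
    exact sequence to which the closure property applies. *)
Lemma closed_factor X0 T (q : {linear X0 -> T}) Y D (y : {linear T -> Y})
    (b : {linear Y -> D}) :
  surj q -> U X0 -> M Y -> ses y b -> coresolved M false U d D ->
  exists Y' (y' : {linear T -> Y'}) (rho : {linear Y -> Y'}) (iota : {linear Y' -> Y}),
    U Y' /\ forall c, rho (y c) = y' c /\ iota (y' c) = y c.
Proof.
move=> surj_q UX0 MY yb chD.
have [Y' [D' [y' [b' [rho [iota [MY' yb' rad_b' chD' yy']]]]]]] :=
  coresolved_minimal clM subU UM (ltnSn d) MY yb chD.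
have [V [f [e [exV inj_e MV UV rad_f]]]] := coresolved_family chD'.
have [inj_y' eyb' surj_b'] := yb'; have [ex_f surj_f] := exV _ _ surj_b'.
exists Y', y', rho, iota; split=> //.
apply: (closedU (X := cons_obj X0 (cons_obj Y' V))
  (f := cons_map (lcomp y' q) (cons_map (lcomp e b') f)) _ _ UX0 UV (i := 1%N)) => //.
- split; last exact: surj_f.
    case=> [|[|i]] // lti; first exact: UM.
    by move: lti; rewrite !ltnS leq_eqVlt => /orP [/eqP -> | /MV //]; exact: UM.
  by case=> [|i] lti; [exact/exact_mono/exact_epi | exact: ex_f].
- case=> [|[|i]] // /andP [_ lti]; last exact: (rad_f i (ltnW lti) isT).
  by move=> g; exact: (rad_b' (lcomp g e)).
Qed.

Lemma trace_generators n N (x : 'I_n -> N) :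
  (forall j, exists X0 (h : {linear X0 -> N}) u, U X0 /\ h u = x j) ->
  exists X0 (h : {linear X0 -> N}), U X0 /\ forall j, exists u, h u = x j.
Proof.
elim: n x => [|n IHn] x trx.
  have [Z Z0] := zero_ex A; exists Z, (lzero Z N).
  by split=> [|[]//]; exact: (subcategory_zero subU).
have [X1 [h1 [UX1 h1E]]] := IHn (fun j => x (lift ord0 j)) (fun j => trx _).
have [X2 [h2 [u2 [UX2 h2E]]]] := trx ord0.
exists (fgprod X1 X2), (ladd (lcomp h1 (lfst X1 X2)) (lcomp h2 (lsnd X1 X2))).
split=> [|j]; first exact: subcategory_prod.
case: (unliftP ord0 j) => [j' ->|->].
  by have [u1 h1u] := h1E j'; exists (u1, 0); rewrite /= linear0 addr0.
by exists (0, u2); rewrite /= linear0 add0r.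
Qed.

(** The submodule generated by the images of all maps from objects of [U]. It
    is finitely generated, so finitely many maps suffice, which combine to a
    map from a direct sum. *)
Lemma trace_ex N : exists T (i : {linear T -> N}) X0 (q : {linear X0 -> T}),
  [/\ injective i, U X0, surj q
    & forall Y (h : {linear Y -> N}), U Y ->
        exists h' : {linear Y -> T}, forall y, i (h' y) = h y].
Proof.
pose tr (x : N) := exists X0 (h : {linear X0 -> N}) u, U X0 /\ h u = x.
have [|T [i [inj_i im_i]]] := @fgsub_ex _ _ N tr.
  split=> [|a _ _ [X1 [h1 [u1 [UX1 <-]]]] [X2 [h2 [u2 [UX2 <-]]]]].
    have [Z Z0] := zero_ex A; exists Z, (lzero Z N), 0.
    by split=> //; exact: (subcategory_zero subU).
  exists (fgprod X1 X2), (ladd (lcomp h1 (lfst X1 X2)) (lcomp h2 (lsnd X1 X2))).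
  by exists (a *: u1, u2); split; [exact: subcategory_prod | rewrite /= linearZ].
have liftU Y (h : {linear Y -> N}) : U Y ->
    exists h' : {linear Y -> T}, forall y, i (h' y) = h y.
  by move=> UY; apply: factor_inj => // y; apply/im_i; exists Y, h, y.
have [n [t gen]] := fgmod_fg T.
have [|X0 [h [UX0 hE]]] := @trace_generators n N (fun j => i (t j)).
  by move=> j; apply/im_i; exists (t j).
have [q iq] := liftU _ h UX0; exists T, i, X0, q; split=> // y.
have /choice [u hu] := hE; have [a ->] := gen y.
exists (\sum_(j < n) a j *: u j); rewrite linear_sum; apply: eq_bigr => j _.
by rewrite linearZ; congr (_ *: _); apply: inj_i; rewrite iq hu.
Qed.

Lemma ses_id_zero C Z : (forall z : Z, z = 0) -> ses (lid C) (lzero C Z).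
Proof.
move=> Z0; split=> // [x|z]; first by split=> // _; exists x.
by exists 0; rewrite (Z0 z).
Qed.

(** The first map of the coresolution of [T] by approximations factors through
    an object [Y'] of [U]; the inclusion of [T] into [N] extends to [Y'], and
    lands in [T], hence provides a retraction. *)
Lemma trace_in_class N T (i : {linear T -> N}) X0 (q : {linear X0 -> T}) :
  M N -> injective i -> U X0 -> surj q ->
  (forall Y (h : {linear Y -> N}), U Y ->
     exists h' : {linear Y -> T}, forall y, i (h' y) = h y) -> U T.
Proof.
move=> MN inj_i UX0 surj_q tr.
have [Z Z0] := zero_ex A; have UZ := subcategory_zero subU Z0.
have [|Y [D [y [b [MY yb chD approx]]]]] := approx_coresolved clM UM
  (ses_id_zero T Z0) (syzygy_of_zero d Z0 UZ) (ltnSn d).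
  by move=> L j _; lia.
have [Y' [y' [rho [iota [UY' yy']]]]] := closed_factor surj_q UX0 MY yb chD.
have [v vy] := approx _ i MN.
have [r ir] := tr _ (lcomp v iota) UY'.
apply: (subcategory_retract (s := y') (t := r) subU _ UY') => c.
by apply: inj_i; rewrite ir /= (yy' c).2 /= vy.
Qed.

(** After the shift of [lift_exact] to a syzygy [K] of [Z], the pullback [E] of
    [N] and [K] has to be considered, where N = W 1. The sequence provided by
    [approx_coresolved] for the extension [E] of [K] by T = W 0 gives a map
    from [E] to [T] that splits the inclusion of [T]; subtracting it
    from the projection to [N] gives a map which factors through [K]. *)
Lemma lift_last (W : nat -> fgmod A) (w : forall i, {linear W i -> W i.+1})
    Z (g : {linear Z -> W d.+2}) :
  right_exact_seq d.+1 M w -> injective (w 0%N) -> U (W 0%N) ->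
  (forall Y (h : {linear Y -> W 1%N}), U Y ->
     exists h' : {linear Y -> W 0%N}, forall y, w 0%N (h' y) = h y) ->
  U Z -> exists g' : {linear Z -> W d.+1}, forall z, w d.+1 (g' z) = g z.
Proof.
move=> [MW ex_w surj_w] inj_w UW0 tr UZ.
apply: (@lift_exact _ _ U d 0 Z (fun i => W i.+1) (fun i => w i.+1) g) => //.
- by move=> i ltid; exact: ex_w.
- by move=> i j ijd; apply: (ct_ext clM (UM UZ) (MW _ _)); lia.
rewrite add0n => K pK h0 im_h0.
pose dl : {linear fgprod (W 1%N) K -> W 2%N} :=
  lsub (lcomp (w 1%N) (lfst (W 1%N) K)) (lcomp h0 (lsnd (W 1%N) K)).
have [E [j [inj_j ejd]]] := ker_ex dl.
have jE e : w 1%N (j e).1 = h0 (j e).2 by apply/subr0_eq; exact: (exact0 e ejd).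
have ex0 := ex_w 0%N isT.
have [|i ji] := exact_lift
  (f := lpair (w 0%N) (lzero (W 0%N) K) : {linear W 0%N -> fgprod (W 1%N) K}) inj_j ejd.
  by move=> x; rewrite /= (exact0 _ ex0) linear0 subr0.
pose qK : {linear E -> K} := lcomp (lsnd (W 1%N) K) j.
have iq : ses i qK.
  split=> [x y ixy|e|z].
  - by apply: inj_w; have := ji x; rewrite ixy ji => -[].
  - split=> [/= e2|[x <-]]; last by rewrite /= ji.
    have /ex0 [x wx] : w 1%N (j e).1 = 0 by rewrite jE e2 linear0.
    by exists x; apply: inj_j; rewrite ji; apply: fgprod_ext.
  - have [x wx] := im_h0 z.
    have /ejd [e je] : dl (x, z) = 0 by rewrite /= wx subrr.
    by exists e; rewrite /qK /= je.
have [|Y [D [y [b [MY yb chD approx]]]]] := approx_coresolved clM UM iq pK (ltnSn d).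
  by move=> L l _; lia.
have [Y' [y' [rho [iota [UY' yy']]]]] :=
  closed_factor (q := lid (W 0%N)) (fun x => ex_intro _ x erefl) UW0 MY yb chD.
have [v vy] := approx _ (lcomp (lfst (W 1%N) K) j) (MW 1%N isT).
have [r wr] := tr _ (lcomp v iota) UY'.
(* On the submodule [W 0] of [E] the projection to [W 1] and the retraction
   [r \o rho \o y] agree, so their difference descends to [K]. *)
pose d0 := lsub (lcomp (lfst (W 1%N) K) j) (lcomp (w 0%N) (lcomp r (lcomp rho y))).
have [inj_i eiq surj_q] := iq.
have [|dl0 dl0q] := exact_desc (f := d0) eiq surj_q.
  move=> x; have [/= y1 y2] := yy' x.
  by rewrite /= y1 wr /= y2 vy /= ji /= subrr.
exists dl0 => z; have [e <-] := surj_q z.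
by rewrite dl0q /= linearB (exact0 _ ex0) subr0 jE.
Qed.

Lemma closed_torsion_class : torsion_class d.+1 M U.
Proof.
move=> N MN; have [T [i [X0 [q [inj_i UX0 surj_q tr]]]]] := trace_ex N.
have UT := trace_in_class MN inj_i UX0 surj_q tr.
have [Q [p ip]] := mono_ses inj_i; have [_ eip surj_p] := ip.
have [Z Z0] := zero_ex A.
pose zero X := forall x : X, x = 0.
have zeroM X : zero X -> M X by exact: (ct_zero clM).
have pZ : syzygy_of zero d Z by exact: syzygy_of_zero.
have [|Y1 [D [y [b [MY1 yb chD _]]]]] := approx_coresolved clM zeroM
  (ses_id_zero Q Z0) pZ (ltnSn d).
  by move=> L j _; lia.
have chQ : coresolved M false zero d.+1 Q.
  by exists Y1, D, (lcomp y (lid Q)), b; split.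
have [Y [f [e [exY inj_e MY Yd _]]]] := coresolved_family chQ.
have [ex_f _] := exY _ _ surj_p.
pose W := cons_obj T (cons_obj N Y).
pose w : forall j, {linear W j -> W j.+1} := cons_map i (cons_map (lcomp e p) f).
have resW : right_exact_seq d.+1 M w.
  split=> [[|[|j]] ltj|[|j] ltj|x] //.
  - exact: UM.
  - exact: MY.
  - exact: exact_mono.
  - by apply: ex_f; exact: ltnW.
  - by apply/(ex_f d (ltnSn d)); exact: Yd.
exists W, w; split=> // V UV j ltj h.
have lift_h : ((j.+1 < d.+1)%N -> forall u, w j.+2 (h u) = 0) ->
    exists h' : {linear V -> W j.+1}, forall u, w j.+1 (h' u) = h u.
  move=> wh; move: (ltj); rewrite ltnS leq_eqVlt => /orP [/eqP jd|ltjd].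
    by subst j; exact: lift_last.
  by apply: (lift_inner clM resW inj_i (UM UV)) => //; exact: wh.
split=> [/lift_h [h' wh']|].
  case: eqP => [j0|_]; last by exists h'.
  subst j; have [h2 ih2] := tr _ h' UV.
  by move=> u; rewrite -wh' -ih2 /= (exact0 _ eip) linear0.
case: eqP => [_ h0 _ u|_ [h' wh'] ltj1 u]; first by rewrite h0 linear0.
by have [_ ex_w _] := resW; rewrite -wh'; exact: exact0 (ex_w j.+1 ltj1).
Qed.

End TorsionClasses.

Theorem theorem3p8 (k : fieldType) (A : falgType k) (d : nat) (hd : (1 <= d)%N)
    (M U : fgmod A -> Prop) (hM : cluster_tilting d M)
    (hU : subcategory U) (hUM : forall X : fgmod A, U X -> M X) :
  torsion_class d M U <->
  (forall (X : nat -> fgmod A) (f : forall i, {linear X i -> X i.+1}),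
     right_exact_seq d M f ->
     (forall i, (1 <= i <= d - 1)%N -> radical (f i)) ->
     U (X 0%N) -> U (X d.+1) ->
     forall i, (1 <= i <= d)%N -> U (X i)).
Proof.
case: d hd hM => [//|d] _ hM; rewrite subn1 /=; split=> [torU X f resX rad_f U0 Ud i|].
  by move=> /andP [_ leid];
    exact: (torsion_class_closed hM hU torU resX rad_f U0 Ud leid).
exact: closed_torsion_class.
Qed.
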